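(* Let $k\ge 0$ be an integer. If $f\colon S^1\to \mathbb{R}^{2k+1}$ is odd and continuous, then there is a subset $X\subseteq S^1$ of diameter at most $\frac{2\pi k}{2k+1}$ such that $\mathrm{conv}(f(X))$ contains the origin.
   Context: The circle $S^1$ carries the geodesic (arc-length) metric of total circumference $2\pi$, and $\mathrm{diam}(X)=\sup\{d(x,y) : x,y\in X\}$ is taken with respect to it. A map $f\colon S^n\to\mathbb{R}^m$ is odd if $f(-x)=-f(x)$ for all $x\in S^n$. $\mathrm{conv}(Y)$ denotes the convex hull of $Y$, i.e. the set of finite convex combinations of points of $Y$. *)

(* Defs.v *)
From mathcomp Require Export all_boot all_order all_algebra.
From mathcomp Require Export all_classical all_reals all_analysis.
Set Implicit Arguments.
Unset Strict Implicit.
Unset Printing Implicit Defensive.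
Export Order.TTheory GRing.Theory Num.Theory.
Export numFieldNormedType.Exports.
Local Open Scope classical_set_scope.
Local Open Scope ring_scope.

Definition dotv (R : realType) (n : nat) (x y : 'rV[R]_n) : R :=
  \sum_(i < n) x 0 i * y 0 i.

(* The library's norm on ['rV[R]_n] is the sup norm, hence the explicit
   Euclidean equation. *)
Definition sphere (R : realType) (n : nat) : set 'rV[R]_n.+1 :=
  [set x | dotv x x = 1].

(* Length of a shortest arc of a great circle joining two points of the unit
   sphere, i.e. the angle between them; see [geodist_circle] for the circle. *)
Definition geodist (R : realType) (n : nat) (x y : 'rV[R]_n) : R :=
  acos (dotv x y).

(* The supremum is taken in the extended reals: [diam set0] is -oo. *)
Definition diam (R : realType) (T : Type) (d : T -> T -> R) (X : set T)
    : \bar R :=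
  ereal_sup [set e | exists x y, [/\ X x, X y & e = (d x y)%:E]].

(* Maps out of the sphere are represented by maps on the ambient space, of
   which only the values on the sphere matter. *)
Definition odd_map (R : realType) (n m : nat)
    (f : 'rV[R]_n.+1 -> 'rV[R]_m) : Prop :=
  forall x, sphere x -> f (- x) = - f x.

Definition conv (R : realType) (V : lmodType R) (Y : set V) : set V :=
  [set p | exists (n : nat) (y : 'I_n -> V) (w : 'I_n -> R),
    [/\ forall i, Y (y i), forall i, 0 <= w i,
        \sum_(i < n) w i = 1 & p = \sum_(i < n) w i *: y i]].

Definition circle_point (R : realType) (t : R) : 'rV[R]_2 :=
  \row_i (if i == 0 then cos t else sin t).

Lemma geodist_circle (R : realType) (s t : R) :
  `|s - t| <= pi -> geodist (circle_point s) (circle_point t) = `|s - t|.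
Proof.
move=> st; rewrite /geodist /dotv !big_ord_recl big_ord0 addr0 !mxE /= -cosB.
by rewrite -cos_norm cosK // in_itv /= normr_ge0.
Qed.

(* Main.v *)
From mathcomp Require Import ring lra.
Require Import Defs.
Set Implicit Arguments.
Unset Strict Implicit.
Unset Printing Implicit Defensive.
Local Open Scope classical_set_scope.
Local Open Scope ring_scope.

(* Put N = 2k+1 and let V be the (N+1)-dimensional space of forms of degree N in
   (cos t, sin t). Send a nonzero p in V to the value of f at a maximum point of p,
   chosen oddly. This map V \ 0 -> R^N is not continuous, but a Borsuk-Ulam theorem
   for arbitrary odd maps still holds: 0 is, up to a small error, a convex
   combination of the values at the vertices of some small simplex. In the limit the
   simplex shrinks to a single p <> 0, and 0 becomes a convex combination of values of f
   at maximum points of p. Since p(t + pi) = - p(t), a theorem of M. Riesz (a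
   maximum and a minimum of a trigonometric polynomial of degree N that are opposite
   extreme values are at least pi / N apart) shows that two maximum points are at
   distance at most pi - pi / N.

   The discrete Borsuk-Ulam theorem is a parity count on mod 2 chains c_0, ..., c_N
   with boundary c_{i+1} = c_i + (antipode of c_i), obtained by subdividing the
   cross-polytope. For a generic odd vertex map h, the number of simplices of c_i over
   which the first i coordinates of h vanish has the same parity for all i. *)

(** * Chains modulo 2 and barycentric subdivision *)

Section Chains.
Variables (T : eqType).
Implicit Types (s : seq T) (c d : seq (seq T)) (phi : seq T -> bool).

(* The complex is augmented: the boundary of a vertex is the empty simplex. *)
Fixpoint bd s : seq (seq T) :=
  if s is x :: s' then s' :: [seq x :: t | t <- bd s'] else [::].

(** A list of simplices stands for a chain modulo 2 and [phi] for a cochain. Testing against all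
    cochains, as [eqc] does, lets repeated simplices cancel without normalising lists. *)
Definition ev phi c : bool := \big[addb/false]_(s <- c) phi s.

Definition eqc c d := forall phi, ev phi c = ev phi d.

Definition bdc c := flatten [seq bd s | s <- c].

Lemma ev_cat phi c d : ev phi (c ++ d) = ev phi c (+) ev phi d.
Proof. by rewrite /ev big_cat. Qed.

Lemma ev_map (S : eqType) phi (F : S -> seq T) (c : seq S) :
  ev phi [seq F x | x <- c] = \big[addb/false]_(x <- c) phi (F x).
Proof. by rewrite /ev big_map. Qed.

Lemma ev_flatten (S : eqType) phi (F : S -> seq (seq T)) (c : seq S) :
  ev phi (flatten [seq F x | x <- c]) = \big[addb/false]_(x <- c) ev phi (F x).
Proof. by rewrite /ev big_flatten big_map. Qed.

Lemma eqc_flatten (F : seq T -> seq (seq T)) c d :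
  eqc c d -> eqc (flatten [seq F s | s <- c]) (flatten [seq F s | s <- d]).
Proof. by move=> e phi; rewrite !ev_flatten; apply: e. Qed.

Lemma eqc_map (F : seq T -> seq T) c d :
  eqc c d -> eqc [seq F s | s <- c] [seq F s | s <- d].
Proof. by move=> e phi; rewrite !ev_map; apply: (e (phi \o F)). Qed.

Lemma bdc_cat c d : bdc (c ++ d) = bdc c ++ bdc d.
Proof. by rewrite /bdc map_cat flatten_cat. Qed.

Lemma ev_bdc_cone phi x c :
  ev phi (bdc [seq x :: s | s <- c]) =
  ev phi c (+) ev phi [seq x :: s | s <- bdc c].
Proof.
rewrite /bdc -map_comp ev_flatten ev_map big_flatten big_map /= -big_split.
by apply: eq_bigr => s _; rewrite /= /ev big_cons big_map.
Qed.

(** By the cone formula [ev_bdc_cone], [bd s] occurs twice and cancels; what remains is a cone over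
    the boundary of [bd s], which vanishes by induction. *)
Lemma ev_bd_bd phi s : ev phi (bdc (bd s)) = false.
Proof.
elim: s phi => [|x s IH] phi; first by rewrite /ev big_nil.
have -> : bdc (bd (x :: s)) = bd s ++ bdc [seq x :: t | t <- bd s] by [].
by rewrite ev_cat ev_bdc_cone addbA addbb ev_map; apply: (IH (phi \o cons x)).
Qed.

Lemma size_bd s t : t \in bd s -> (size t).+1 = size s.
Proof.
elim: s t => [//|x s IH] t /=; rewrite inE => /predU1P[->//|].
by case/mapP=> u /IH us -> /=; rewrite us.
Qed.

Lemma bd_rem s : uniq s -> bd s = [seq rem x s | x <- s].
Proof.
elim: s => [//|x s IH] /= /andP[xs us]; rewrite eqxx; congr cons.
rewrite IH // -map_comp; apply/eq_in_map => y ys /=.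
by case: eqVneq => // xy; rewrite xy ys in xs.
Qed.

Lemma subseq_bd s t : t \in bd s -> subseq t s.
Proof.
elim: s t => [//|x s IH] t /=; rewrite inE => /predU1P[->|].
  exact: subseq_cons.
by case/mapP => u /IH us -> /=; rewrite eqxx.
Qed.

End Chains.

Arguments bdc {T} c.

(** * Barycentric subdivision as a chain map *)

Section Subdivision.
Variables (R : numFieldType) (V : lmodType R).
Implicit Types (s t : seq V) (c d : seq (seq V)).

Definition bary s : V := (size s)%:R^-1 *: \sum_(x <- s) x.

(** [m] is both the recursion depth and the intended number of vertices of [s]. The subdivision is
    the cone from the barycentre over the subdivided boundary. *)
Fixpoint sd m s : seq (seq V) :=
  if m is m'.+1 then
    [seq bary s :: t | t <- flatten [seq sd m' t | t <- bd s]]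
  else [:: [::]].

Definition sdc m c := flatten [seq sd m s | s <- c].

Definition antip c := [seq [seq - x | x <- s] | s <- c].

Lemma sdc_cat m c d : sdc m (c ++ d) = sdc m c ++ sdc m d.
Proof. by rewrite /sdc map_cat flatten_cat. Qed.

Lemma eqc_sdc m c d : eqc c d -> eqc (sdc m c) (sdc m d).
Proof. exact: eqc_flatten. Qed.

Lemma sdc_bdc m c : sdc m (bdc c) = flatten [seq sdc m (bd s) | s <- c].
Proof. by rewrite /sdc /bdc; elim: c => //= s c IH; rewrite map_cat flatten_cat IH. Qed.

Lemma bdc_sdc m c : bdc (sdc m c) = flatten [seq bdc (sd m s) | s <- c].
Proof. by rewrite /sdc /bdc; elim: c => //= s c IH; rewrite map_cat flatten_cat IH. Qed.

(** The boundary of a cone is its base plus the cone over the boundary of the base. By induction the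
    boundary of the base is the subdivision of the boundary of [bd s], hence zero. *)
Lemma bd_sd m s : size s = m.+1 -> eqc (bdc (sd m.+1 s)) (sdc m (bd s)).
Proof.
elim: m s => [|m IH] s sm phi.
  case: s sm => [//|x [|//]] _ /=.
  by rewrite /sdc /bdc /=.
rewrite [sd _ _]/= -/(sdc m.+1 (bd s)) ev_bdc_cone.
suff /eqc_map -> : eqc (bdc (sdc m.+1 (bd s))) [::].
  by rewrite {2}/ev big_nil addbF.
move=> psi; rewrite bdc_sdc ev_flatten.
transitivity (ev psi (sdc m (bdc (bd s)))).
  rewrite sdc_bdc ev_flatten big_seq [RHS]big_seq; apply: eq_bigr => t ts.
  by apply: IH; apply/eqP; rewrite -eqSS (size_bd ts) sm.
have bb0 : eqc (bdc (bd s)) [::] by move=> chi; rewrite ev_bd_bd /ev big_nil.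
exact: (eqc_sdc m bb0 psi).
Qed.

Lemma bdc_sd m c : all (fun s => size s == m.+1) c ->
  eqc (bdc (sdc m.+1 c)) (sdc m (bdc c)).
Proof.
move=> /allP cm phi; rewrite bdc_sdc sdc_bdc !ev_flatten big_seq [RHS]big_seq.
by apply: eq_bigr => s /cm/eqP sm; apply: bd_sd.
Qed.

Lemma bary_opp s : bary [seq - x | x <- s] = - bary s.
Proof. by rewrite /bary size_map big_map sumrN scalerN. Qed.

Lemma bd_map (U W : eqType) (F : U -> W) (s : seq U) :
  bd (map F s) = map (map F) (bd s).
Proof.
by elim: s => //= x s ->; congr cons; rewrite -!map_comp; apply: eq_map.
Qed.

Lemma sd_opp m s : sd m [seq - x | x <- s] = antip (sd m s).
Proof.
elim: m s => [//|m IH] s; rewrite /antip /= bary_opp bd_map -!map_comp.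
elim: (bd s) => //= t b IHb; rewrite !map_cat IHb IH; congr cat.
by rewrite /antip -!map_comp.
Qed.

Lemma sdc_antip m c : sdc m (antip c) = antip (sdc m c).
Proof.
by rewrite /sdc /antip; elim: c => //= s c IH; rewrite sd_opp map_cat IH.
Qed.

Lemma bdc_antip c : bdc (antip c) = antip (bdc c).
Proof. by rewrite /bdc /antip; elim: c => //= s c IH; rewrite bd_map map_cat IH. Qed.

Lemma size_sd m s t : size s = m -> t \in sd m s -> size t = m.
Proof.
elim: m s t => [|m IH] s t sm /=; first by rewrite inE => /eqP->.
case/mapP=> u /flatten_mapP[v vs uv] -> /=; congr S; apply: IH uv.
by apply/eqP; rewrite -eqSS (size_bd vs) sm.
Qed.

(* Closure of a predicate under barycentres is the only form of convexity
   that the subdivision needs. *)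
Lemma sd_closed (K : V -> Prop) m s t :
  (forall u, u != [::] -> (forall x, x \in u -> K x) -> K (bary u)) ->
  size s = m -> (forall x, x \in s -> K x) -> t \in sd m s ->
  forall x, x \in t -> K x.
Proof.
move=> Kb; elim: m s t => [|m IH] s t sm Ks /=.
  by rewrite inE => /eqP-> x.
case/mapP=> u /flatten_mapP[v vs uv] -> x; rewrite inE => /predU1P[->|].
  by apply: Kb => //; rewrite -size_eq0 sm.
apply: (IH v) uv _ => [|y yv]; first by apply/eqP; rewrite -eqSS (size_bd vs) sm.
by apply: Ks; apply: (mem_subseq (subseq_bd vs)).
Qed.

End Subdivision.

(** * Subdivided hemispheres of the cross-polytope *)

Section Hemispheres.
Variables (R : realType) (n : nat).
Implicit Types (s t : seq 'rV[R]_n.+1) (c d : seq (seq 'rV[R]_n.+1)).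

Definition evec (j : nat) : 'rV[R]_n.+1 := \row_i (i == j :> nat)%:R.

(* The upper half of the boundary of the [m+1]-dimensional cross-polytope. *)
Fixpoint hemi m : seq (seq 'rV[R]_n.+1) :=
  if m is m'.+1 then
    [seq evec m :: s | s <- hemi m' ++ antip (hemi m')]
  else [:: [:: evec 0]].

Lemma hemiS m :
  hemi m.+1 = [seq evec m.+1 :: s | s <- hemi m ++ antip (hemi m)].
Proof. by []. Qed.

Definition sdhemi r m := iter r (sdc m.+1) (hemi m).

Lemma size_antip m c : {in c, forall s, size s = m} ->
  {in antip c, forall s, size s = m}.
Proof. by move=> cm s /mapP[t /cm <- ->]; rewrite size_map. Qed.

Lemma size_hemi m : {in hemi m, forall s, size s = m.+1}.
Proof.
elim: m => [|m IH] s /=; first by rewrite inE => /eqP->.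
case/mapP=> t; rewrite mem_cat => /orP[/IH|/(size_antip IH)] ts -> /=; by rewrite ts.
Qed.

Lemma antipK : involutive (@antip R 'rV[R]_n.+1).
Proof.
move=> c; rewrite /antip -map_comp -[RHS]map_id; apply: eq_map => s /=.
by rewrite -map_comp -[RHS]map_id; apply: eq_map => x /=; rewrite opprK.
Qed.

Lemma ev_antip_cat phi c : ev phi (antip (c ++ antip c)) = ev phi (c ++ antip c).
Proof.
by rewrite {1}/antip map_cat -!/(antip _) antipK !ev_cat addbC.
Qed.

Lemma bdc_hemi m : eqc (bdc (hemi m.+1)) (hemi m ++ antip (hemi m)).
Proof.
(* Such a [c] added to its antipode is a cycle: its boundary is invariant under the antipode and so
   is counted twice. *)
have closed k c : eqc (bdc c) (hemi k ++ antip (hemi k)) ->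
    eqc (bdc (c ++ antip c)) [::].
  move=> e phi; rewrite bdc_cat bdc_antip ev_cat /ev big_nil.
  rewrite -/(ev _ _) -/(ev phi (antip _)).
  have /eqc_map/(_ phi) := e; rewrite -/(antip (bdc c)) => ->.
  by rewrite e -/(antip _) ev_antip_cat addbb.
elim: m => [|m IH] phi; rewrite hemiS ev_bdc_cone.
  by rewrite [X in _ (+) X]/ev /= !big_cons big_nil addbF addbb addbF.
have /eqc_map -> := closed _ _ IH.
by rewrite [X in _ (+) X]/ev big_nil addbF.
Qed.

Lemma size_sdc m c : {in c, forall s, size s = m} ->
  {in sdc m c, forall s, size s = m}.
Proof. by move=> cm s /flatten_mapP[t /cm tm]; apply: size_sd. Qed.

Lemma size_sdhemi r m : {in sdhemi r m, forall s, size s = m.+1}.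
Proof. by elim: r => [|r IH]; [apply: size_hemi | apply: size_sdc]. Qed.

Lemma bdc_sdhemi r m :
  eqc (bdc (sdhemi r m.+1)) (sdhemi r m ++ antip (sdhemi r m)).
Proof.
elim: r => [|r IH] phi; first exact: bdc_hemi.
rewrite /sdhemi !iterS -/(sdhemi r m.+1) -/(sdhemi r m).
rewrite bdc_sd; last by apply/allP => s /size_sdhemi ->.
by rewrite -sdc_antip -sdc_cat; apply: eqc_sdc.
Qed.

Lemma sdhemi0 r : sdhemi r 0 = [:: [:: evec 0]].
Proof.
elim: r => //= r ->; rewrite /sdc /= /bary /= big_seq1.
by rewrite invr1 scale1r.
Qed.

Lemma free_rem s x : free s -> x \in s -> free (rem x s).
Proof.
by move=> fs xs; move: fs; rewrite (perm_free (perm_to_rem xs)) free_cons => /andP[].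
Qed.

Lemma free_bd s t : free s -> t \in bd s -> free t.
Proof.
by move=> fs; rewrite bd_rem ?free_uniq // => /mapP[x xs ->]; apply: free_rem.
Qed.

(** Up to a nonzero factor the barycentre is [x] plus a vector of the span, so membership would put
    [x] itself there, against freeness. *)
Lemma bary_notin_span s x : free s -> x \in s -> bary s \notin <<rem x s>>%VS.
Proof.
move=> fs xs; move: (fs); rewrite (perm_free (perm_to_rem xs)) free_cons.
move=> /andP[xr _]; apply: contra xr; rewrite /bary.
have s0 : (size s)%:R != 0 :> R by rewrite pnatr_eq0 size_eq0; case: (s) xs.
rewrite rpredZeq invr_eq0 (negPf s0) /= (big_rem _ xs) /=.
by rewrite rpredDr // big_seq; apply: memv_suml => y yr; apply: memv_span.
Qed.

Lemma memv_bary (U : {vspace 'rV[R]_n.+1}) s :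
  (forall x, x \in s -> x \in U) -> bary s \in U.
Proof.
by move=> sU; apply: memvZ; rewrite big_seq; apply: memv_suml.
Qed.

(** The vertices of a subdivided face stay in the span of that face, which misses the barycentre of
    [s]; coning therefore preserves independence. *)
Lemma free_sd m s t : size s = m -> free s -> t \in sd m s -> free t.
Proof.
elim: m s t => [|m IH] s t sm fs /=.
  by rewrite inE => /eqP->; rewrite nil_free.
case/mapP=> u /flatten_mapP[v vs uv] ->; rewrite free_cons.
have vm : size v = m by apply/eqP; rewrite -eqSS (size_bd vs) sm.
rewrite (IH v) ?(free_bd fs) // andbT.
move: vs; rewrite bd_rem ?free_uniq // => /mapP[x xs ev]; subst v.
apply: contra (bary_notin_span fs xs); apply/subvP/span_subvP => y.
apply: (sd_closed (K := fun y => y \in <<rem x s>>%VS)) uv _ => // [w _|z].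
  exact: memv_bary.
exact: memv_span.
Qed.

(* A linear form with coefficients in [-1, 1] and value 1 on the simplex bounds its
   vertices away from 0 and excludes antipodal pairs. *)
Definition face_form s := exists a : 'I_n.+1 -> R,
  (forall i, `|a i| <= 1) /\ (forall x, x \in s -> \sum_i a i * x 0 i = 1).

(** The vanishing of the coordinates beyond [m] drives the induction: it keeps the next apex outside
    the span of the simplex and leaves a coefficient of the form free to be reset. *)
Lemma hemiP m s : s \in hemi m ->
  [/\ forall x (i : 'I_n.+1), x \in s -> (m < i)%N -> x 0 i = 0,
      forall x (i : 'I_n.+1), x \in s -> `|x 0 i| <= 1,
      (m <= n)%N -> free s & (m <= n)%N -> face_form s].
Proof.
have e_out (m' : nat) (i : 'I_n.+1) : (m' < i)%N -> evec m' 0 i = 0.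
  by move=> mi; rewrite mxE gtn_eqF.
have e_le (m' : nat) (i : 'I_n.+1) : `|evec m' 0 i| <= 1.
  by rewrite mxE; case: eqP => _; rewrite ?normr1 ?normr0.
elim: m s => [|m IH] s /=.
  rewrite inE => /eqP->; split=> [x i|x i|_|_]; rewrite ?inE.
  - by move=> /eqP->; apply: e_out.
  - by move=> /eqP->.
  - rewrite seq1_free; apply/eqP => /matrixP/(_ 0 ord0); rewrite !mxE eqxx.
    by move/eqP; rewrite oner_eq0.
  exists (fun i : 'I_n.+1 => (i == 0 :> nat)%:R); split=> [i|x].
    by case: eqP => _; rewrite ?normr1 ?normr0.
  rewrite inE => /eqP->; rewrite (bigD1 ord0) //= !mxE eqxx mulr1 big1 ?addr0 //.
  by move=> i i0; rewrite mxE -val_eqE /= in i0 *; rewrite (negPf i0) mul0r.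
case/mapP=> t ts ->.
have {ts}[t_out t_le t_free t_form] :
  [/\ forall x (i : 'I_n.+1), x \in t -> (m < i)%N -> x 0 i = 0,
      forall x (i : 'I_n.+1), x \in t -> `|x 0 i| <= 1,
      (m <= n)%N -> free t & (m <= n)%N -> face_form t].
  move: ts; rewrite mem_cat => /orP[/IH//|/mapP[u /IH[u1 u2 u3 u4] ->]].
  split=> [x i /mapP[y yu ->] mi|x i /mapP[y yu ->]|mn|mn].
  - by rewrite mxE (u1 y) ?oppr0.
  - by rewrite mxE normrN (u2 y).
  - have := u3 mn; elim: (u) => [//|y v IHv].
    rewrite /= !free_cons => /andP[yv /IHv ->]; rewrite andbT.
    rewrite memvN; apply: contra yv; apply/subvP/span_subvP => z /mapP[w wv ->].
    by rewrite memvN memv_span.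
  - have [a [a1 a2]] := u4 mn; exists (fun i => - a i).
    split=> [i|x /mapP[y yu ->]]; first by rewrite normrN.
    by rewrite -(a2 y yu); apply: eq_bigr => i _; rewrite mxE mulrNN.
split=> [x i|x i|mn|mn]; rewrite ?inE.
- by case/predU1P => [->|xt] mi; [apply: e_out | apply: t_out => //; apply: ltnW].
- by case/predU1P => [->|xt]; [apply: e_le | apply: t_le].
- rewrite free_cons t_free ?(ltnW mn) // andbT; apply/negP.
  have mn1 : (m.+1 < n.+1)%N by [].
  move=> /(coord_span (X := in_tuple t))/matrixP/(_ 0 (Ordinal mn1)).
  rewrite !mxE eqxx summxE big1 => [/eqP|i _]; first by rewrite oner_eq0.
  by rewrite mxE (t_out _ _ (mem_nth 0 _)) ?mulr0 //=.
have [a [a1 a2]] := t_form (ltnW mn).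
have mn1 : (m.+1 < n.+1)%N by [].
(* The apex sees only the new coefficient, the old vertices only the old ones. *)
exists (fun i : 'I_n.+1 => if i == m.+1 :> nat then 1 else a i); split=> [i|x].
  by case: ifP => // _; rewrite normr1.
rewrite inE => /predU1P[->|xt].
  rewrite (bigD1 (Ordinal mn1)) //= mxE /= eqxx mulr1 big1 ?addr0 // => i.
  by rewrite -val_eqE /= mxE => /negPf->; rewrite mulr0.
rewrite -(a2 x xt); apply: eq_bigr => i _; case: eqP => // im.
by rewrite t_out ?mulr0 // im.
Qed.

End Hemispheres.

Lemma sum_const_seq (W : nmodType) (T : Type) (s : seq T) (z : W) :
  \sum_(x <- s) z = z *+ size s.
Proof. by rewrite big_const_seq count_predT iter_addr addr0. Qed.

(** * Mesh of the iterated subdivision *)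

Section Mesh.
Variables (R : realType) (n : nat).
Implicit Types (s t u : seq 'rV[R]_n.+1).

Lemma bary_sum (I : finType) (a : I -> R) (j : I -> 'I_n.+1) s (z : R) : s != [::] ->
  \sum_i a i * bary s 0 (j i) - z =
  (size s)%:R^-1 * \sum_(x <- s) (\sum_i a i * x 0 (j i) - z).
Proof.
move=> s0; have s1 : (size s)%:R != 0 :> R by rewrite pnatr_eq0 size_eq0.
rewrite sumrB mulrBr sum_const_seq -[z *+ _]mulr_natl.
rewrite mulrA mulVf // mul1r; congr (_ - _).
rewrite exchange_big mulr_sumr; apply: eq_bigr => i _ /=.
by rewrite !mxE summxE mulrCA -mulr_sumr.
Qed.

Lemma bary_coord s (i : 'I_n.+1) (z : R) : s != [::] ->
  bary s 0 i - z = (size s)%:R^-1 * \sum_(x <- s) (x 0 i - z).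
Proof.
move=> /(bary_sum (fun=> 1) (fun _ : 'I_1 => i) z).
rewrite big_ord_recl big_ord0 addr0 mul1r => ->; congr (_ * _).
by apply: eq_bigr => x _; rewrite big_ord_recl big_ord0 addr0 mul1r.
Qed.

Lemma bary_ball i (z r : R) u : u != [::] ->
  (forall x, x \in u -> `|x 0 i - z| <= r) -> `|bary u 0 i - z| <= r.
Proof.
move=> u0 ur; rewrite bary_coord // normrM.
have u1 : 0 < (size u)%:R :> R by rewrite ltr0n lt0n size_eq0.
rewrite gtr0_norm ?invr_gt0 // ler_pdivrMl //.
apply: le_trans (ler_norm_sum _ _ _) _.
rewrite mulr_natl -sum_const_seq big_seq [leRHS]big_seq.
exact: ler_sum.
Qed.

Lemma bary_form (a : 'I_n.+1 -> R) (u : seq 'rV[R]_n.+1) : u != [::] ->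
  (forall x, x \in u -> \sum_i a i * x 0 i = 1) -> \sum_i a i * bary u 0 i = 1.
Proof.
move=> u0 ua; apply/eqP; rewrite -subr_eq0 (bary_sum a id) // big_seq big1 ?mulr0 //.
by move=> x /ua ->; rewrite subrr.
Qed.

(** For m+1 vertices, the barycentre minus a vertex [x] is an average of m+1 differences with [x],
    one of them zero; this gives the factor m/(m+1), at most n/(n+1). By convexity the bound extends
    from vertices of a face to those of its subdivision, and two vertices inside a subdivided face
    are handled by induction. *)
Lemma sd_diam m s t i (D : R) : size s = m -> (m <= n.+1)%N ->
  (forall x y, x \in s -> y \in s -> `|x 0 i - y 0 i| <= D) -> t \in sd m s ->
  forall x y, x \in t -> y \in t -> `|x 0 i - y 0 i| <= n%:R / n.+1%:R * D.
Proof.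
elim: m s t => [|m IH] s t sm mn sD /=; first by rewrite inE => /eqP-> x.
case/mapP=> u /flatten_mapP[v vs uv] -> {t}.
have vm : size v = m by apply/eqP; rewrite -eqSS (size_bd vs) sm.
have vD x : x \in v -> x \in s by apply/mem_subseq/subseq_bd.
have s0 : s != [::] by rewrite -size_eq0 sm.
have D0 : 0 <= D.
  case: s s0 sD {sm vs vD} => // x s _ /(_ x x); rewrite inE eqxx => /(_ isT isT).
  by rewrite subrr normr0.
have bs x : x \in s -> `|bary s 0 i - x 0 i| <= n%:R / n.+1%:R * D.
  move=> xs; rewrite bary_coord // (big_rem _ xs) /= subrr add0r.
  have r_le : `|\sum_(y <- rem x s) (y 0 i - x 0 i)| <= m%:R * D.
    have <- : size (rem x s) = m by rewrite size_rem // sm.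
    apply: le_trans (ler_norm_sum _ _ _) _.
    rewrite mulr_natl -sum_const_seq big_seq [leRHS]big_seq.
    by apply: ler_sum => y yr; apply: sD => //; apply: mem_rem yr.
  rewrite normrM sm gtr0_norm ?invr_gt0 ?ltr0n //.
  rewrite ler_pdivrMl ?ltr0n //; apply: le_trans r_le _.
  rewrite !mulrA ler_wpM2r // ler_pdivlMr ?ltr0n //.
  by rewrite -!natrM ler_nat mulnS mulSn leq_add2r.
have bu x : x \in u -> `|bary s 0 i - x 0 i| <= n%:R / n.+1%:R * D.
  move=> xu; rewrite distrC; move: x xu; apply: sd_closed vm _ uv => [w|x xv].
    exact: bary_ball.
  by rewrite distrC; apply/bs/vD.
move=> x y; rewrite !inE => /predU1P[->|xu] /predU1P[->|yu].
- by rewrite subrr normr0 mulr_ge0 // divr_ge0.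
- exact: bu.
- by rewrite distrC; apply: bu.
- apply: (IH v u) => //; first exact: ltnW.
  by move=> z w /vD zs /vD; apply: sD.
Qed.

Lemma sdhemi_free r m : (m <= n)%N -> {in sdhemi R n r m, forall s, free s}.
Proof.
move=> mn; elim: r => [|r IH] s; first by case/hemiP=> _ _ /(_ mn).
case/flatten_mapP=> t tr; apply: free_sd; last exact: IH.
exact: size_sdhemi tr.
Qed.

Lemma sdhemi_form r m : (m <= n)%N -> {in sdhemi R n r m, forall s, face_form s}.
Proof.
move=> mn; elim: r => [|r IH] s; first by case/hemiP=> _ _ _ /(_ mn).
case/flatten_mapP=> t tr st; have [a [a1 a2]] := IH _ tr; exists a; split=> //.
apply: (sd_closed (K := fun x : 'rV[R]_n.+1 => \sum_i a i * x 0 i = 1)) st => //.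
  by move=> u; apply: bary_form.
exact: size_sdhemi tr.
Qed.

Lemma sdhemi_le1 r m s x i : s \in sdhemi R n r m -> x \in s -> `|x 0 i| <= 1.
Proof.
move=> sr; elim: r s sr x => [|r IH] s.
  by case/hemiP => _ + _ _ x => /(_ x i).
case/flatten_mapP=> t tr st.
apply: (sd_closed (K := fun x : 'rV[R]_n.+1 => `|x 0 i| <= 1)) st => //.
- move=> u u0 u1; rewrite -[_ 0 i]subr0; apply: bary_ball => // x xu.
  by rewrite subr0; apply: u1.
- exact: size_sdhemi tr.
- exact: IH.
Qed.

Lemma sdhemi_diam r s x y i : s \in sdhemi R n r n -> x \in s -> y \in s ->
  `|x 0 i - y 0 i| <= (n%:R / n.+1%:R) ^+ r * 2.
Proof.
move=> sr; elim: r s sr x y => [|r IH] s sr x y.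
  move=> /(sdhemi_le1 i (r := 0) sr) xi /(sdhemi_le1 i (r := 0) sr) yi.
  by rewrite expr0 mul1r (le_trans (ler_normB _ _)) // lerD.
move: sr; case/flatten_mapP=> t tr st; rewrite exprS -mulrA.
by move: x y; apply: sd_diam st => //; [exact: size_sdhemi tr | exact: IH].
Qed.

Lemma exists_small_mesh (e : R) : 0 < e -> exists r, (n%:R / n.+1%:R) ^+ r * 2 <= e.
Proof.
move=> e0; have q1 : `|n%:R / n.+1%:R : R| < 1.
  by rewrite ger0_norm ?divr_ge0 // ltr_pdivrMr ?ltr0n // mul1r ltr_nat.
have /cvgrPdist_le/(_ (e / 2)) := cvg_expr q1.
rewrite divr_gt0 // => /(_ isT)[r _ /(_ r (leqnn r))] /=.
rewrite sub0r normrN ger0_norm ?exprn_ge0 ?divr_ge0 // => h; exists r.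
by rewrite -ler_pdivlMr.
Qed.

End Mesh.

(** * Parity of the number of zeros *)

Section Parity.
Variables (R : realType) (T : eqType) (h : T -> nat -> R).
Implicit Types (s t : seq T) (a b : T -> R).

Definition comb a s j := \sum_(v <- s) a v * h v j.

(* The image of [s] under the first [m] coordinates of [h] contains 0 (resp. under the
   first [m.+1] coordinates, meets the positive half of the last axis). *)
Definition pos_zero m s : bool := `[< exists a,
  (forall v, v \in s -> 0 < a v) /\ (forall j, (j < m)%N -> comb a s j = 0) >].

Definition pos_ray m s : bool := `[< exists a,
  [/\ forall v, v \in s -> 0 < a v, forall j, (j < m)%N -> comb a s j = 0
    & 0 < comb a s m] >].

Definition minor s : 'M[R]_(size s) :=
  \matrix_(i, j) h (tnth (in_tuple s) i) j.

(** The determinant takes as many coordinates of [h] as [s] has vertices; indexing coordinates by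
    [nat] lets one map serve simplices of every dimension. *)
Definition generic s := \det (minor s) != 0.

Lemma combD a b s j : comb (fun v => a v + b v) s j = comb a s j + comb b s j.
Proof. by rewrite -big_split; apply: eq_bigr => v _; rewrite mulrDl. Qed.

Lemma combZ c a s j : comb (fun v => c * a v) s j = c * comb a s j.
Proof. by rewrite mulr_sumr; apply: eq_bigr => v _; rewrite mulrA. Qed.

Lemma comb_rem a s v j : v \in s -> comb a s j = a v * h v j + comb a (rem v s) j.
Proof. exact: big_rem. Qed.

Lemma eq_comb a b s j : {in s, a =1 b} -> comb a s j = comb b s j.
Proof. by move=> ab; apply: eq_big_seq => v /ab ->. Qed.

Lemma generic_inj a s : generic s -> (forall j, (j < size s)%N -> comb a s j = 0) ->
  forall v, v \in s -> a v = 0.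
Proof.
move=> gs as0 v vs; pose u : 'rV_(size s) := \row_i a (tnth (in_tuple s) i).
have su : minor s \in unitmx by rewrite unitmxE unitfE.
have : u *m minor s = 0.
  apply/rowP => j; rewrite !mxE -[RHS](as0 j) // [RHS]big_tnth.
  by apply: eq_bigr => i _; rewrite !mxE.
move/(congr1 (mulmx^~ (invmx (minor s)))); rewrite mulmxK // mul0mx => u0.
move: vs; rewrite -index_mem => vs.
have := congr1 (fun w : 'rV_(size s) => w 0 (Ordinal vs)) u0.
by rewrite !mxE (tnth_nth v) /= nth_index // -index_mem.
Qed.

Lemma generic_solve s (b : nat -> R) : uniq s -> generic s ->
  exists a, forall j, (j < size s)%N -> comb a s j = b j.
Proof.
move=> us gs; have su : minor s \in unitmx by rewrite unitmxE unitfE.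
pose u : 'rV_(size s) := (\row_j b j) *m invmx (minor s).
(* The solution is indexed by positions; since [s] has no repetition it becomes a function of the
   vertex, with default 0 off [s]. *)
exists (fun v => if insub (index v s) is Some i then u 0 i else 0) => j js.
have := congr1 (fun w : 'rV_(size s) => w 0 (Ordinal js)) (mulmxKV su (\row_j b j)).
rewrite mxE [RHS]mxE => <-; rewrite [LHS]big_tnth; apply: eq_bigr => i _.
congr (_ * _); last by rewrite mxE.
by rewrite (tnth_nth (tnth (in_tuple s) i)) /= index_uniq // valK.
Qed.

Lemma seq_argmax (F : T -> R) s : s != [::] ->
  exists2 a, a \in s & {in s, forall x, F x <= F a}.
Proof.
elim: s => [//|x [|y s] IH _]; first by exists x => [|z]; rewrite inE => // /eqP->.
have [//|a as_ am] := IH; have [xa|ax] := leP (F x) (F a).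
  by exists a => [|z]; rewrite inE ?as_ ?orbT // => /predU1P[->//|/am].
exists x => [|z]; rewrite inE ?eqxx // => /predU1P[->//|/am] za.
exact: le_trans za (ltW ax).
Qed.

Lemma big_addb_pred1 s (p : T -> bool) x : uniq s -> x \in s ->
  {in s, forall y, p y -> y = x} -> \big[addb/false]_(v <- s) p v = p x.
Proof.
move=> us xs px; rewrite (bigD1_seq x) //= big_seq_cond big1 ?addbF //.
by move=> y /andP[ys yx]; apply/negP => /(px y ys) /eqP; rewrite (negPf yx).
Qed.

(* The half-lines [t < t_v] or [t > t_v] meet in an interval, which has an even number
   of end points unless it is unbounded. *)
Lemma interval_ends (a l : T -> R) (t : T -> R) s v0 : uniq s -> {in s &, injective t} ->
  {in s, forall x, l x != 0} -> v0 \in s -> 0 < l v0 ->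
  \big[addb/false]_(v <- s) all (fun x => 0 < l x * (t v - t x)) (rem v s) =
  all (fun x => 0 < l x) s.
Proof.
move=> us tinj l0 v0s lv0; pose pos := [seq x <- s | 0 < l x].
pose neg := [seq x <- s | l x < 0]; pose p v := all (fun x => 0 < l x * (t v - t x)) (rem v s).
have pP v : v \in s -> reflect {in s, forall x, x != v -> 0 < l x * (t v - t x)} (p v).
  move=> vs; apply: (iffP allP) => [pv x xs xv|pv x].
    by apply: pv; rewrite mem_rem_uniq // !inE xv.
  by rewrite mem_rem_uniq // !inE => /andP[xv xs]; apply: pv.
have lt_t x y : x \in s -> y \in s -> x != y -> t x <= t y -> t x < t y.
  move=> xs ys xy le; rewrite lt_neqAle le andbT; apply: contra xy => /eqP e.
  by apply/eqP/tinj.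
(* [m] gives the largest lower bound on the parameter; [b], below, gives the smallest upper bound.
   These are the only possible ends, and when [b] exists both are ends or neither is, according to
   [t m < t b]. *)
have [m] : exists2 m, m \in pos & {in pos, forall x, t x <= t m}.
  by apply: seq_argmax; apply/eqP => /(congr1 (fun r => v0 \in r)); rewrite mem_filter lv0 v0s.
rewrite mem_filter => /andP[lm ms] mmax.
have mlt x : x \in s -> 0 < l x -> x != m -> t x < t m.
  by move=> xs lx xm; apply: lt_t => //; apply: mmax; rewrite mem_filter lx.
have pm v : v \in s -> 0 < l v -> p v -> v = m.
  move=> vs lv /pP-/(_ vs m ms); case: (eqVneq m v) => [->//|mv /(_ isT)].
  rewrite pmulr_rgt0 // subr_gt0 => /lt_trans/(_ (mlt v vs lv _)).
  by rewrite ltxx eq_sym => /(_ mv).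
have [allpos|] := boolP (all (fun x => 0 < l x) s).
  rewrite (@big_addb_pred1 _ p m) //; last first.
    by move=> v vs; apply: pm => //; apply: (allP allpos).
  apply/pP => // x xs xm; rewrite mulr_gt0 ?subr_gt0 ?mlt //; exact: (allP allpos).
case/allPn => z zs lz.
have [b] : exists2 b, b \in neg & {in neg, forall x, - t x <= - t b}.
  apply: seq_argmax; apply/eqP => /(congr1 (fun r => z \in r)).
  by rewrite mem_filter zs andbT lt_neqAle l0 // leNgt lz.
rewrite mem_filter => /andP[lb bs] bmin.
have blt x : x \in s -> l x < 0 -> x != b -> t b < t x.
  move=> xs lx xb; apply: lt_t => //; first by rewrite eq_sym.
  by rewrite -lerN2; apply: bmin; rewrite mem_filter lx.
have mb : m != b by apply: contraTneq lm => ->; rewrite -leNgt ltW.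
have pb v : v \in s -> l v < 0 -> p v -> v = b.
  move=> vs lv /pP-/(_ vs b bs); case: (eqVneq b v) => [->//|bv /(_ isT)].
  rewrite nmulr_rgt0 // subr_lt0 => /lt_trans/(_ (blt v vs lv _)).
  by rewrite ltxx eq_sym => /(_ bv).
have pmE : p m = (t m < t b).
  apply/pP/idP => // [/(_ b bs)|tmb x xs xm].
    by rewrite eq_sym mb => /(_ isT); rewrite nmulr_rgt0 // subr_lt0.
  have [lx|lx|/eqP] := ltgtP (l x) 0; last by rewrite (negPf (l0 x xs)).
    rewrite nmulr_rgt0 // subr_lt0; case: (eqVneq x b) => [->//|xb].
    exact: lt_trans tmb (blt _ _ _ _).
  by rewrite pmulr_rgt0 // subr_gt0 mlt.
have pbE : p b = (t m < t b).
  apply/pP/idP => // [/(_ m ms mb)|tmb x xs xb].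
    by rewrite pmulr_rgt0 // subr_gt0.
  have [lx|lx|/eqP] := ltgtP (l x) 0; last by rewrite (negPf (l0 x xs)).
    by rewrite nmulr_rgt0 // subr_lt0 blt.
  rewrite pmulr_rgt0 // subr_gt0; case: (eqVneq x m) => [->//|xm].
  exact: lt_trans (mlt _ _ _ _) tmb.
rewrite -/(p) (perm_big _ (perm_to_rem ms)) big_cons /=.
have br : b \in rem m s by rewrite mem_rem_uniq // !inE eq_sym mb.
rewrite (big_addb_pred1 (rem_uniq _ us) br) -/(p _) -/(p _) ?pmE ?pbE ?addbb //.
move=> v; rewrite mem_rem_uniq // !inE => /andP[vm vs] pv; apply: pb => //.
rewrite ltNge le_eqVlt eq_sym (negPf (l0 v vs)) /=.
by apply: contra vm => lv; apply/eqP/pm.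
Qed.

(** Coefficients on [s] for which the first [m] combinations are 0 and the next is 1 form a line
    [al + t * l], where [l] spans the relations among the first [m.+1] coordinates. The positive
    orthant cuts an interval from this line. Its ends, where one coefficient vanishes, are the faces
    counted on the left; their number is odd exactly when [l] is positive, which is the condition on
    the right. *)
Lemma pos_ray_faces m s : uniq s -> size s = m.+2 ->
  (forall x, x \in s -> generic (rem x s)) ->
  (forall x y, x \in s -> y \in rem x s -> generic (rem y (rem x s))) ->
  ev (pos_ray m) (bd s) = pos_zero m.+1 s.
Proof.
move=> us sm g1 g2; have [v0 v0s] : exists v0, v0 \in s.
  by case: (s) sm => // x s' _; exists x; rewrite mem_head.
have sz1 x : x \in s -> size (rem x s) = m.+1 by move=> xs; rewrite size_rem // sm.
have sz2 x y : x \in s -> y \in rem x s -> size (rem y (rem x s)) = m.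
  by move=> xs ys; rewrite size_rem // sz1.
have inj1 a v : v \in s -> a v = 0 -> (forall j, (j < m.+1)%N -> comb a s j = 0) ->
    {in s, forall x, a x = 0}.
  move=> vs av as0 x xs; case: (eqVneq x v) => [->//|xv].
  apply: (generic_inj (g1 v vs)); last by rewrite mem_rem_uniq // !inE xv.
  by move=> j; rewrite sz1 // => /as0; rewrite (comb_rem _ _ vs) av mul0r add0r.
have inj2 a v w : v \in s -> w \in s -> v != w -> a v = 0 -> a w = 0 ->
    (forall j, (j < m)%N -> comb a s j = 0) -> {in s, forall x, a x = 0}.
  move=> vs ws vw av aw as0 x xs; case: (eqVneq x v) => [->//|xv].
  case: (eqVneq x w) => [->//|xw].
  have wr : w \in rem v s by rewrite mem_rem_uniq // !inE eq_sym vw.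
  have ur : uniq (rem v s) by rewrite rem_uniq.
  apply: (generic_inj (g2 v w vs wr)); last first.
    by rewrite mem_rem_uniq // !inE xw mem_rem_uniq // !inE xv.
  move=> j; rewrite sz2 // => /as0; rewrite (comb_rem _ _ vs) av mul0r add0r.
  by rewrite (comb_rem _ _ wr) aw mul0r add0r.
have [al alE] : exists al, forall j, (j < m.+1)%N -> comb al s j = (j == m)%:R.
  have [a aE] := generic_solve (fun j => (j == m)%:R) (rem_uniq v0 us) (g1 v0 v0s).
  exists (fun x => if x == v0 then 0 else a x) => j jm.
  rewrite (comb_rem _ _ v0s) eqxx mul0r add0r -aE ?sz1 //.
  by apply: eq_comb => x; rewrite mem_rem_uniq // !inE => /andP[/negPf->].
have [l [l1 lE]] : exists l, l v0 = 1 /\ forall j, (j < m.+1)%N -> comb l s j = 0.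
  have [a aE] := generic_solve (fun j => - h v0 j) (rem_uniq v0 us) (g1 v0 v0s).
  exists (fun x => if x == v0 then 1 else a x); split=> [|j jm]; first by rewrite eqxx.
  rewrite (comb_rem _ _ v0s) eqxx mul1r; apply/eqP.
  rewrite addrC addr_eq0 -aE ?sz1 //; apply/eqP.
  by apply: eq_comb => x; rewrite mem_rem_uniq // !inE => /andP[/negPf->].
have l0 : {in s, forall x, l x != 0}.
  move=> x xs; apply/eqP => lx; have := inj1 l x xs lx lE v0 v0s.
  by rewrite l1 => /eqP; rewrite oner_eq0.
(* The parameter at which the coefficient of [v] vanishes on the line. *)
pose t v := - (al v / l v).
have tE v x : v \in s -> x \in s -> al x + t v * l x = l x * (t v - t x).
  move=> vs xs; have -> : al x = - (l x * t x).
    by rewrite /t mulrN opprK mulrCA divff ?l0 // mulr1.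
  by rewrite mulrBr [t v * _]mulrC addrC.
have lineE v j : (j < m.+1)%N -> comb (fun x => al x + t v * l x) s j = (j == m)%:R.
  by move=> jm; rewrite combD combZ lE // mulr0 addr0 alE.
(* A shared parameter would give a point of the line with two zero coefficients; genericity of a
   face of codimension two kills the others, against the value 1 in coordinate [m]. *)
have tinj : {in s &, injective t}.
  move=> v w vs ws tvw; apply/eqP; apply: contraT => vw.
  have z := inj2 (fun x => al x + t v * l x) v w vs ws vw.
  have: comb (fun x => al x + t v * l x) s m = 1 by rewrite lineE ?eqxx.
  rewrite (@eq_comb _ (fun=> 0)) => [|x xs]; last first.
    apply: z => //; rewrite ?tE ?tvw ?subrr ?mulr0 // => j jm.
    by rewrite -tvw lineE ?ltnS ?(ltnW jm) // (ltn_eqF jm).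
  rewrite /comb big1 => [/eqP|x _]; last by rewrite mul0r.
  by rewrite eq_sym oner_eq0.
(* Every relation among the first [m.+1] coordinates is a multiple of [l], and [l v0 = 1] fixes its
   sign. *)
rewrite bd_rem // ev_map; transitivity (all (fun x => 0 < l x) s); last first.
  apply/allP/asboolP => [lpos|[b [bpos b0]] x xs]; first by exists l.
  have := inj1 (fun x => b x + - b v0 * l x) v0 v0s.
  rewrite l1 mulr1 subrr => /(_ erefl) bl.
  have := bl _ x xs; rewrite mulNr => /(_ _)/subr0_eq bx.
  have {}bx : b x = b v0 * l x.
    by apply: bx => j jm; rewrite combD combZ b0 // lE // mulr0 addr0.
  by move: (bpos x xs); rewrite bx pmulr_rgt0 // bpos.
rewrite -(interval_ends al us tinj l0 v0s) ?l1 //.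
apply: eq_big_seq => v vs.
have rs x : x \in rem v s -> x \in s by apply: mem_rem.
have lv0 : al v + t v * l v = 0 by rewrite tE // subrr mulr0.
have lineEr j : (j < m.+1)%N -> comb (fun x => al x + t v * l x) (rem v s) j = (j == m)%:R.
  by move=> jm; rewrite -(lineE v j jm) [RHS](comb_rem _ _ vs) lv0 mul0r add0r.
apply/asboolP/allP => [[b [bpos b0 bm]] x xr|lpos].
  (* Scaled to value 1 in coordinate [m], a solution on the face opposite [v] must be the point of
     the line at parameter [t v]. *)
  have bE : b x = comb b (rem v s) m * (al x + t v * l x).
    apply/eqP; rewrite -subr_eq0 -mulNr; apply/eqP.
    apply: (generic_inj (a := fun x => b x + - comb b (rem v s) m * (al x + t v * l x))
             (g1 v vs)) => // j; rewrite sz1 // => jm.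
    rewrite combD combZ lineEr //; move: jm; rewrite ltnS leq_eqVlt.
    case/predU1P => [->|jm]; first by rewrite eqxx mulr1 subrr.
    by rewrite b0 // (ltn_eqF jm) mulr0 addr0.
  by move: (bpos x xr); rewrite bE pmulr_rgt0 // tE // rs.
exists (fun x => al x + t v * l x); split=> [x xr|j jm|].
- by rewrite tE ?(rs x) // lpos.
- by have := lineEr j (leqW jm); rewrite (ltn_eqF jm); exact.
- have : 0 < comb (fun x => al x + t v * l x) (rem v s) m by rewrite lineEr // eqxx.
  exact.
Qed.

End Parity.

(** * Counting zeros of an odd vertex map *)

Section OddCount.
Variables (R : realType) (n : nat) (h : 'rV[R]_n.+1 -> nat -> R).
Hypothesis h_odd : forall v j, v != 0 -> h (- v) j = - h v j.
Implicit Types (s t : seq 'rV[R]_n.+1).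

Lemma face_form_neq0 s x : face_form s -> x \in s -> x != 0.
Proof.
move=> [a [_ a1]] xs; apply/eqP => x0; have := a1 x xs.
rewrite x0 big1 => [/eqP|i _]; last by rewrite mxE mulr0.
by rewrite eq_sym oner_eq0.
Qed.

Lemma comb_antip a s j : {in s, forall x, x != 0} ->
  comb h a [seq - x | x <- s] j = - comb h (fun x => a (- x)) s j.
Proof.
move=> s0; rewrite /comb big_map -sumrN; apply: eq_big_seq => x xs.
by rewrite h_odd ?s0 // mulrN.
Qed.

(** By genericity a positive combination on the last axis is off the origin, hence on one half of
    the axis; oddness moves the negative half to the antipodal simplex. If both halves were met, a
    positive combination would hit the origin. *)
Lemma pos_zero_ray m s : size s = m.+1 -> generic h s -> {in s, forall x, x != 0} ->
  pos_zero h m s = pos_ray h m s (+) pos_ray h m [seq - x | x <- s].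
Proof.
move=> sm gs s0; have [v0 v0s] : exists v0, v0 \in s.
  by case: (s) sm => // x s' _; exists x; rewrite mem_head.
have rayN : pos_ray h m [seq - x | x <- s] = `[< exists a,
    [/\ forall v, v \in s -> 0 < a v, forall j, (j < m)%N -> comb h a s j = 0
      & comb h a s m < 0] >].
  have inv b : (forall v, v \in s -> 0 < b v) ->
      forall v, v \in [seq - x | x <- s] -> 0 < b (- v).
    by move=> bpos v /mapP[x xs ->]; rewrite opprK bpos.
  apply/asboolP/asboolP => -[a [apos a0 am]]; exists (fun x => a (- x)); split=> [v vs|j jm|].
  - by apply: apos; apply: map_f.
  - by apply/eqP; rewrite -oppr_eq0 -comb_antip // a0.
  - by rewrite -oppr_gt0 -comb_antip.
  - exact: inv vs.
  - rewrite comb_antip // (@eq_comb _ _ _ _ a) ?a0 ?oppr0 // => x _.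
    by rewrite opprK.
  - rewrite comb_antip // (@eq_comb _ _ _ _ a) ?oppr_gt0 // => x _.
    by rewrite opprK.
have nz a : (forall v, v \in s -> 0 < a v) -> (forall j, (j < m)%N -> comb h a s j = 0) ->
    comb h a s m != 0.
  move=> apos a0; apply/eqP => am; have := apos v0 v0s.
  rewrite (generic_inj gs) ?ltxx // => j; rewrite sm ltnS leq_eqVlt.
  by case/predU1P => [->|/a0].
rewrite rayN; apply/idP/idP => [/asboolP[a [apos a0]]|].
  have excl : ~~ (pos_ray h m s && `[< exists a,
      [/\ forall v, v \in s -> 0 < a v, forall j, (j < m)%N -> comb h a s j = 0
        & comb h a s m < 0] >]).
    apply/negP => /andP[/asboolP[b [bpos b0 bm]] /asboolP[c [cpos c0 cm]]].
    apply: (negP (nz (fun x => - comb h c s m * b x + comb h b s m * c x) _ _)).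
    - by move=> v vs; rewrite addr_gt0 ?mulr_gt0 ?oppr_gt0 ?bpos ?cpos.
    - by move=> j jm; rewrite combD !combZ (b0 j) // (c0 j) // !mulr0 addr0.
    - by rewrite combD !combZ mulNr mulrC addNr.
  have := nz a apos a0; case: (ltgtP (comb h a s m) 0) => // am _; move: excl.
    have -> : `[< exists a, [/\ forall v, v \in s -> 0 < a v,
        forall j, (j < m)%N -> comb h a s j = 0 & comb h a s m < 0] >].
      by apply/asboolP; exists a.
    by rewrite andbT => /negPf->.
  have -> : pos_ray h m s by apply/asboolP; exists a.
  by rewrite andTb => /negPf->.
have xor_or (p q : bool) : p (+) q -> p || q by case: p; case: q.
by move=> /xor_or/orP[] /asboolP[a [apos a0 _]]; apply/asboolP; exists a.
Qed.

(** Summing [pos_ray_faces] over the chain turns zeros into rays over its boundary, a hemisphere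
    plus its antipode one dimension lower; [pos_zero_ray] turns these back into zeros over that
    hemisphere. The induction starts from a single vertex. *)
Lemma odd_pos_zero r m : (m <= n)%N ->
  (forall k s t, (k <= n)%N -> s \in sdhemi R n r k -> subseq t s -> (size t <= n)%N ->
    generic h t) ->
  ev (pos_zero h m) (sdhemi R n r m).
Proof.
move=> + gen; elim: m => [|m IH] mn.
  rewrite sdhemi0 /ev big_seq1; apply/asboolP; exists (fun=> 1).
  by split=> [v _|j]; [exact: ltr01 | rewrite ltn0].
have -> : ev (pos_zero h m.+1) (sdhemi R n r m.+1) =
    ev (pos_ray h m) (bdc (sdhemi R n r m.+1)).
  rewrite ev_flatten; apply: eq_big_seq => s sr; apply/esym.
  have sm := size_sdhemi sr; have us := free_uniq (sdhemi_free mn sr).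
  apply: pos_ray_faces => // [x xs|x y xs ys]; apply: (gen m.+1 s) => //.
  - exact: rem_subseq.
  - by rewrite size_rem // sm.
  - exact: subseq_trans (rem_subseq _ _) (rem_subseq _ _).
  - by rewrite !size_rem // sm; apply: leq_trans mn; rewrite /= ltnW.
rewrite bdc_sdhemi ev_cat ev_map /ev -big_split /=.
have {IH} := IH (ltnW mn); rewrite /ev; congr is_true; apply: eq_big_seq => s sr.
apply: pos_zero_ray; first exact: size_sdhemi sr.
  by apply: (gen m s) => //; rewrite ?(ltnW mn) // (size_sdhemi sr).
by move=> x; apply: face_form_neq0; apply: sdhemi_form sr; apply: ltnW.
Qed.

End OddCount.

(** * Perturbation into general position *)

Section Genericity.
Variable R : realType.

(** Each determinant is a polynomial in [c], nonzero since at [c = 0] it is the one for [mo]. The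
    product of these finitely many polynomials has a nonroot among [B], [B + 1], and so on. *)
Lemma exists_generic (T : eqType) (g mo : T -> nat -> R) (E : seq (seq T)) (B : R) :
  {in E, forall t, generic mo t} ->
  exists2 c, B <= c & {in E, forall t, generic (fun v j => c * g v j + mo v j) t}.
Proof.
move=> gmo; have [q q0 qE] : exists2 q : {poly R}, q != 0 &
    forall c, q.[c] != 0 -> {in E, forall t, generic (fun v j => c * g v j + mo v j) t}.
  elim: E gmo => [|t E IH] gmo; first by exists 1; rewrite ?oner_eq0.
  have [|q q0 qE] := IH; first by move=> u uE; apply: gmo; rewrite inE uE orbT.
  pose p := \det (\matrix_(i < size t, j < size t)
    ((g (tnth (in_tuple t) i) j)%:P * 'X + (mo (tnth (in_tuple t) i) j)%:P)).
  have pE c : p.[c] = \det (minor (fun v j => c * g v j + mo v j) t).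
    rewrite -horner_evalE -det_map_mx; congr (\det _); apply/matrixP => i j.
    by rewrite !mxE /= horner_evalE !hornerE mulrC.
  have p0 : p != 0.
    apply: contraTneq (gmo t (mem_head _ _)) => pz; rewrite /generic negbK.
    have := pE 0; rewrite pz horner0 => /esym/eqP; congr (\det _ == 0).
    by apply/matrixP => i j; rewrite !mxE mul0r add0r.
  exists (p * q) => [|c]; first by rewrite mulf_neq0.
  rewrite hornerM mulf_eq0 negb_or => /andP[pc /qE qc] u.
  rewrite inE => /predU1P[->|/qc//].
  by rewrite /generic -pE.
have [i /negPf iq] : exists i : nat, q.[B + i%:R] != 0.
  apply: contrapT => /forallNP all0.
  pose rs := [seq B + i%:R | i <- iota 0 (size q)].
  suff : (size rs < size q)%N by rewrite size_map size_iota ltnn.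
  apply: max_poly_roots => //.
    by apply/allP => x /mapP[i _ ->]; apply/rootP/eqP/negPn/negP/all0.
  by rewrite map_inj_uniq ?iota_uniq // => i j /addrI/eqP; rewrite eqr_nat => /eqP.
by exists (B + i%:R); [rewrite lerDl | apply: qE; rewrite iq].
Qed.

(** The vectors are nonzero multiples of distinct points of the moment curve. *)
Lemma generic_vandermonde (T : eqType) (sg u : T -> R) (t : seq T) : uniq t ->
  (forall v, v \in t -> sg v != 0) -> {in t &, injective u} ->
  generic (fun v j => sg v * u v ^+ j) t.
Proof.
move=> ut sg0 uinj; rewrite /generic.
have -> : minor (fun v j => sg v * u v ^+ j) t =
    diag_mx (\row_i sg (tnth (in_tuple t) i)) *m
    (Vandermonde (size t) (\row_i u (tnth (in_tuple t) i)))^T.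
  by apply/matrixP => i j; rewrite mul_diag_mx !mxE.
rewrite det_mulmx det_diag det_tr det_Vandermonde mulf_neq0 //.
  by apply/prodf_neq0 => i _; rewrite mxE sg0 // (mem_tnth i (in_tuple t)).
apply/prodf_neq0 => i _; apply/prodf_neq0 => j ij; rewrite !mxE subr_eq0.
apply/eqP => /uinj; rewrite !(mem_tnth _ (in_tuple t)) => /(_ isT isT) e.
have /tuple_uniqP/(_ _ _ e) ji : uniq (in_tuple t) by [].
by rewrite ji ltnn in ij.
Qed.

End Genericity.

Section OddSign.
Variables (R : realType) (n : nat).
Implicit Types v w : 'rV[R]_n.

(** One vector is selected from each antipodal pair; multiplying a function of [rep v] by the sign
    [osg] makes it odd away from 0. *)
Definition rep v := choose (pred2 v (- v)) v.

Definition osg v : R := if rep v == v then 1 else -1.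

Lemma repN v : rep (- v) = rep v.
Proof.
rewrite /rep (@eq_choose _ _ (pred2 v (- v))) => [|x]; last by rewrite /= opprK orbC.
by apply: choose_id; rewrite /= eqxx ?orbT.
Qed.

Lemma repP v : rep v = v \/ rep v = - v.
Proof.
have : pred2 v (- v) (rep v) by apply: chooseP; rewrite /= eqxx.
by case/orP => /eqP; [left | right].
Qed.

Lemma osgN v : v != 0 -> osg (- v) = - osg v.
Proof.
move=> v0; have vN : v != - v.
  by rewrite -addr_eq0 -mulr2n -scaler_nat scaler_eq0 pnatr_eq0.
rewrite /osg repN; case: (repP v) => ->; rewrite ?eqxx ?(negPf vN) //.
by rewrite eq_sym (negPf vN) opprK.
Qed.

Lemma norm_osg v : `|osg v| = 1.
Proof. by rewrite /osg; case: ifP; rewrite ?normrN normr1. Qed.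

End OddSign.

Definition sublists (T : Type) (s : seq T) :=
  [seq mask (tval m) s | m : (size s).-tuple bool].

Lemma mem_sublists (T : eqType) (s t : seq T) : (t \in sublists s) = subseq t s.
Proof.
apply/mapP/subseqP => [[m _ ->]|[m ms ->]]; first by exists m; rewrite ?size_tuple.
by exists (tcast ms (in_tuple m)); rewrite ?mem_enum // val_tcast.
Qed.

(** Only equal or antipodal vectors share a representative, and a form with value 1 on both vertices
    excludes the antipodal case. *)
Lemma rep_inj_on (R : realType) n (s : seq 'rV[R]_n.+1) : face_form s ->
  {in s &, injective (@rep R n.+1)}.
Proof.
move=> [a [_ a1]] x y xs ys xy; have [//|xNy] : x = y \/ x = - y.
  by case: (repP x) (repP y) => + [] + ; rewrite xy => -> ; [left|right|right|left];
    rewrite ?opprK //; apply: oppr_inj; rewrite ?opprK.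
have := a1 x xs; rewrite xNy (eq_bigr (fun i => - (a i * y 0 i))) => [|i _]; last first.
  by rewrite mxE mulrN.
by rewrite sumrN a1 // => /eqP; rewrite lt_eqF // (lt_trans _ ltr01) ?ltrN10.
Qed.

(** An odd moment-curve map [mo], bounded by [B], is added to a large multiple [c * g] to reach
    general position. The parity count gives an exact zero of the sum, which is a zero of [g] up to
    [B / c <= d]. *)
Theorem discrete_borsuk_ulam (R : realType) (n : nat) (g : 'rV[R]_n.+1 -> nat -> R)
    (d : R) : (forall v j, v != 0 -> g (- v) j = - g v j) -> 0 < d ->
  exists (s : seq 'rV[R]_n.+1) (w : 'rV[R]_n.+1 -> R),
    [/\ size s = n.+1 /\ face_form s,
        (forall x i, x \in s -> `|x 0 i| <= 1) /\
        (forall x y i, x \in s -> y \in s -> `|x 0 i - y 0 i| <= d),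
        forall x, x \in s -> 0 <= w x, \sum_(x <- s) w x = 1
      & forall j, (j < n)%N -> `|\sum_(x <- s) w x * g x j| <= d].
Proof.
move=> godd d0; have [r rd] := exists_small_mesh n d0.
pose E0 := flatten [seq sdhemi R n r k | k <- iota 0 n.+1].
pose L := [seq rep v | v <- flatten E0].
(* Positions in the finite list of representatives separate the vertices of each simplex and are
   bounded by the length of the list. *)
pose u v : R := (index (rep v) L)%:R.
pose mo v j := osg v * u v ^+ j.
have E0P k s : (k <= n)%N -> s \in sdhemi R n r k -> s \in E0.
  by move=> kn sk; apply/flatten_mapP; exists k; rewrite // mem_iota.
have mo_generic : {in flatten [seq sublists s | s <- E0], forall t, generic mo t}.
  move=> t /flatten_mapP[s sE]; rewrite mem_sublists => ts.
  move/flatten_mapP: (sE) => -[k]; rewrite mem_iota ltnS => kn sk.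
  have sf := sdhemi_form kn sk; have us := free_uniq (sdhemi_free kn sk).
  apply: generic_vandermonde; first exact: subseq_uniq us.
    by move=> v _; rewrite -normr_eq0 norm_osg oner_eq0.
  move=> x y /(mem_subseq ts) xs /(mem_subseq ts) ys /eqP; rewrite eqr_nat => /eqP xy.
  apply: (rep_inj_on sf) => //.
  have L_rep z : z \in s -> rep z \in L.
    by move=> zs; apply: map_f; apply/flattenP; exists s.
  by rewrite -[rep x](nth_index 0 (L_rep x xs)) -[rep y](nth_index 0 (L_rep y ys)) xy.
pose B : R := ((size L)%:R + 1) ^+ n.
have B1 : 1 <= B by rewrite exprn_ege1 // lerDr.
have mo_le v j : (j < n)%N -> `|mo v j| <= B.
  move=> jn; rewrite normrM norm_osg mul1r normrX.
  apply: (@le_trans _ _ (((size L)%:R + 1) ^+ j)).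
    by rewrite lerXn2r ?nnegrE // ?addr_ge0 // normr_nat natr1 ler_nat leqW // index_size.
  by rewrite ler_weXn2l ?lerDr // ltnW.
have [c cB gen] := @exists_generic R _ g mo _ (B / d) mo_generic.
have c0 : 0 < c by apply: lt_le_trans cB; rewrite divr_gt0 // (lt_le_trans ltr01).
pose h v j := c * g v j + mo v j.
have h_odd v j : v != 0 -> h (- v) j = - h v j.
  move=> v0; rewrite /h /mo /u godd // osgN // repN.
  by rewrite mulrN mulNr opprD.
have : ev (pos_zero h n) (sdhemi R n r n).
  apply: odd_pos_zero => // k s t kn sk ts _; apply: gen.
  by apply/flatten_mapP; exists s; rewrite ?mem_sublists //; apply: E0P sk.
have [/hasP[s sr /asboolP[a [apos a0]]] _|/hasPn none] :=
  boolP (has (pos_zero h n) (sdhemi R n r n)); last first.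
  rewrite /ev big_seq big1 // => s sr; apply/negbTE; exact: none.
have s_size := size_sdhemi sr.
pose A := \sum_(x <- s) a x.
have A0 : 0 < A.
  have [v0 v0s] : exists v0, v0 \in s.
    by case: (s) s_size => // x s' _; exists x; rewrite mem_head.
  rewrite /A (big_rem _ v0s) /=; apply: ltr_wpDr; last exact: apos.
  by rewrite big_seq sumr_ge0 // => x /mem_rem xs; rewrite ltW // apos.
exists s, (fun x => a x / A); split.
- by split=> //; apply: sdhemi_form sr.
- split=> [x i xs|x y i xs ys]; first exact: sdhemi_le1 sr xs.
  exact: le_trans (sdhemi_diam i sr xs ys) rd.
- by move=> x xs; rewrite divr_ge0 ?ltW // apos.
- by rewrite -mulr_suml divff // gt_eqF.
move=> j jn; have -> : \sum_(x <- s) a x / A * g x j =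
    - (c^-1 * \sum_(x <- s) a x / A * mo x j).
  apply/eqP; rewrite -addr_eq0; apply/eqP.
  have := a0 j jn; rewrite /comb /h.
  rewrite (eq_bigr (fun x => (c * A) * (a x / A * g x j + c^-1 * (a x / A * mo x j)))).
    rewrite -mulr_sumr big_split -mulr_sumr => /eqP.
    by rewrite mulf_eq0 mulf_eq0 (gt_eqF c0) (gt_eqF A0) => /eqP.
  by move=> x _; field; rewrite (gt_eqF c0) (gt_eqF A0).
rewrite normrN normrM gtr0_norm ?invr_gt0 // ler_pdivrMl //.
apply: (@le_trans _ _ B); last by rewrite -ler_pdivrMr.
apply: le_trans (ler_norm_sum _ _ _) _.
have aA1 : \sum_(x <- s) a x / A = 1 by rewrite -mulr_suml divff // gt_eqF.
rewrite -[leRHS]mul1r -aA1 mulr_suml big_seq [leRHS]big_seq; apply: ler_sum => x xs.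
have aA : 0 <= a x / A by rewrite divr_ge0 ?ltW // apos.
by rewrite normrM ger0_norm // ler_wpM2l // mo_le.
Qed.

(** * Trigonometric forms and their extrema *)

Section Continuity.
Variables (R : realType) (X : topologicalType).

Lemma continuous_at_sum (I : Type) (r : seq I) (F : I -> X -> R) x :
  (forall i, {for x, continuous (F i)}) ->
  {for x, continuous (fun y => \sum_(i <- r) F i y)}.
Proof.
move=> Fx; elim: r => [|i r IH].
  by rewrite (_ : (fun _ => _) = fun=> 0);
    [exact: cst_continuous | apply/funext => y; rewrite big_nil].
rewrite (_ : (fun _ => _) = fun y => F i y + \sum_(j <- r) F j y); last first.
  by apply/funext => y; rewrite big_cons.
by apply: continuousD; [exact: Fx | exact: IH].
Qed.

Lemma continuous_at_expr (F : X -> R) k x :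
  {for x, continuous F} -> {for x, continuous (fun y => F y ^+ k)}.
Proof.
move=> Fx; elim: k => [|k IH].
  by rewrite (_ : (fun _ => _) = fun=> 1);
    [exact: cst_continuous | apply/funext => y; rewrite expr0].
rewrite (_ : (fun _ => _) = fun y => F y * F y ^+ k); last first.
  by apply/funext => y; rewrite exprS.
by apply: continuousM; [exact: Fx | exact: IH].
Qed.

End Continuity.

Section HomogeneousTrig.
Variable R : realType.
Implicit Types (a : nat -> R) (f g : R -> R) (N : nat).

Definition homtrig N a (t : R) :=
  \sum_(j < N.+1) a j * (cos t ^+ (N - j) * sin t ^+ j).

Definition is_homtrig N f := exists a, forall t, f t = homtrig N a t.

Lemma is_homtrigD N f g : is_homtrig N f -> is_homtrig N g ->
  is_homtrig N (fun t => f t + g t).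
Proof.
move=> [a fa] [b gb]; exists (fun j => a j + b j) => t.
by rewrite fa gb -big_split; apply: eq_bigr => j _; rewrite mulrDl.
Qed.

Lemma is_homtrigZ N c f : is_homtrig N f -> is_homtrig N (fun t => c * f t).
Proof.
move=> [a fa]; exists (fun j => c * a j) => t.
by rewrite fa mulr_sumr; apply: eq_bigr => j _; rewrite mulrA.
Qed.

Lemma is_homtrigM_cos N f : is_homtrig N f -> is_homtrig N.+1 (fun t => cos t * f t).
Proof.
move=> [a fa]; exists (fun j => if (j <= N)%N then a j else 0) => t.
rewrite fa mulr_sumr /homtrig [RHS]big_ord_recr /= ltnn mul0r addr0; apply: eq_bigr => j _.
by rewrite -ltnS ltn_ord subSn -1?ltnS // exprS mulrCA !mulrA.
Qed.

Lemma is_homtrigM_sin N f : is_homtrig N f -> is_homtrig N.+1 (fun t => sin t * f t).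
Proof.
move=> [a fa]; exists (fun j => if j is j'.+1 then a j' else 0) => t.
rewrite fa mulr_sumr /homtrig [RHS]big_ord_recl /= mul0r add0r; apply: eq_bigr => j _.
by rewrite /bump /= add1n subSS [in RHS]exprS mulrCA; congr (_ * _); rewrite mulrCA.
Qed.

Lemma is_homtrigM N f c d : is_homtrig N f ->
  is_homtrig N.+1 (fun t => (c * cos t + d * sin t) * f t).
Proof.
move=> hf; have := is_homtrigD (is_homtrigZ c (is_homtrigM_cos hf))
  (is_homtrigZ d (is_homtrigM_sin hf)).
by case=> a aE; exists a => t; rewrite -aE mulrDl !mulrA.
Qed.

Lemma eq_is_homtrig N f g : f =1 g -> is_homtrig N f -> is_homtrig N g.
Proof. by move=> fg [a fa]; exists a => t; rewrite -fg. Qed.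

Lemma is_homtrig1 : is_homtrig 0 (fun=> 1).
Proof. by exists (fun=> 1) => t; rewrite /homtrig big_ord1 !expr0 !mulr1. Qed.

Lemma is_homtrig_sum (I : Type) (r : seq I) (F : I -> R -> R) N :
  (forall i, is_homtrig N (F i)) -> is_homtrig N (fun t => \sum_(i <- r) F i t).
Proof.
move=> hF; elim: r => [|i r IH].
  exists (fun=> 0) => t; rewrite big_nil /homtrig big1 // => j _; exact: mul0r.
by apply: eq_is_homtrig (is_homtrigD (hF i) IH) => t; rewrite big_cons.
Qed.

Lemma is_homtrig_shift N f c : is_homtrig N f -> is_homtrig N (fun t => f (t + c)).
Proof.
move=> [a fa]; suff : is_homtrig N (fun t => \sum_(j < N.+1)
    a j * (cos (t + c) ^+ (N - j) * sin (t + c) ^+ j)).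
  by apply: eq_is_homtrig => t; rewrite fa.
apply: is_homtrig_sum => j; apply: is_homtrigZ.
have sin_pow q : is_homtrig q (fun t => sin (t + c) ^+ q).
  elim: q => [|q IH]; first exact: is_homtrig1.
  apply: eq_is_homtrig (is_homtrigM (sin c) (cos c) IH) => t.
  by rewrite exprS sinD; congr (_ * _); rewrite addrC mulrC [sin c * _]mulrC.
have {1}-> : N = (N - j + j)%N by rewrite subnK // -ltnS.
elim: (N - j)%N => [|p IH].
  by apply: eq_is_homtrig (sin_pow j) => t; rewrite expr0 mul1r.
apply: eq_is_homtrig (is_homtrigM (cos c) (- sin c) IH) => t.
by rewrite exprS cosD -mulrA mulNr mulrC [sin c * _]mulrC [cos c * _]mulrC mulrC.
Qed.

Lemma is_homtrig_cosn N :
  is_homtrig N (fun t => cos (N%:R * t)) /\ is_homtrig N (fun t => sin (N%:R * t)).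
Proof.
elim: N => [|N [IHc IHs]].
  split; first by apply: eq_is_homtrig is_homtrig1 => t; rewrite mul0r cos0.
  apply: eq_is_homtrig (is_homtrigZ 0 is_homtrig1) => t.
  by rewrite !mul0r sin0.
have e t : N.+1%:R * t = t + N%:R * t by rewrite -natr1 mulrDl mul1r addrC.
split.
  apply: eq_is_homtrig (is_homtrigD (is_homtrigM_cos IHc)
    (is_homtrigZ (-1) (is_homtrigM_sin IHs))) => t.
  by rewrite e cosD mulN1r.
apply: eq_is_homtrig (is_homtrigD (is_homtrigM_cos IHs) (is_homtrigM_sin IHc)) => t.
by rewrite e sinD addrC.
Qed.

Lemma is_homtrig_cos N c : is_homtrig N (fun t => cos (N%:R * (t - c))).
Proof. exact: (is_homtrig_shift (- c) (is_homtrig_cosn N).1). Qed.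

Lemma homtrigDpi N a t : homtrig N a (t + pi) = (-1) ^+ N * homtrig N a t.
Proof.
rewrite /homtrig mulr_sumr; apply: eq_bigr => j _; rewrite cosDpi sinDpi [RHS]mulrCA.
congr (_ * _); rewrite -[- cos t]mulN1r -[- sin t]mulN1r !exprMn mulrACA.
by rewrite -exprD subnK // -ltnS.
Qed.

Lemma homtrig_continuous N a : continuous (homtrig N a).
Proof.
move=> t; apply: continuous_at_sum => j; apply: continuousM; first exact: cst_continuous.
apply: continuousM; apply: continuous_at_expr; [exact: continuous_cos | exact: continuous_sin].
Qed.

Lemma homtrig_tan N a t : cos t != 0 ->
  homtrig N a t = cos t ^+ N * (\poly_(j < N.+1) a j).[tan t].
Proof.
move=> ct; rewrite horner_poly mulr_sumr; apply: eq_bigr => j _.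
have jN : (j <= N)%N by rewrite -ltnS.
have -> : cos t ^+ N = cos t ^+ (N - j) * cos t ^+ j by rewrite -exprD subnK.
rewrite [RHS]mulrCA; congr (_ * _); rewrite /tan expr_div_n [_ / _]mulrC [RHS]mulrA.
by rewrite mulfK ?expf_neq0.
Qed.

(** Division by [cos t ^+ N] leaves a polynomial of degree at most [N] in [tan t], and the tangent
    is injective on this interval. *)
Lemma homtrig_roots N a (r : seq R) : uniq r -> (N < size r)%N ->
  {in r, forall t, - (pi / 2) < t < pi / 2 /\ homtrig N a t = 0} ->
  forall j, (j <= N)%N -> a j = 0.
Proof.
move=> ur Nr r0 j jN; pose p := \poly_(j < N.+1) a j.
have cos0 t : t \in r -> cos t != 0 by move=> /r0[/cos_gt0_pihalf/gt_eqF->].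
suff p0 : p = 0 by have := coef_poly N.+1 a j; rewrite -/p p0 coef0 ltnS jN.
apply/eqP; apply: contraT => pn0.
suff : (size [seq tan t | t <- r] < N.+1)%N by rewrite size_map ltnS leqNgt Nr.
apply: leq_trans (max_poly_roots pn0 _ _) (size_poly _ _); last first.
  rewrite map_inj_in_uniq // => x y /r0[xp _] /r0[yp _].
  by apply: tan_inj; rewrite in_itv.
apply/allP => x /mapP[t tr ->]; apply/rootP/eqP.
have [_ /eqP] := r0 t tr; rewrite homtrig_tan ?cos0 // mulf_eq0 expf_eq0.
by rewrite (negPf (cos0 t tr)) andbF.
Qed.

End HomogeneousTrig.

(** * Distance between opposite extreme values *)

Section RieszExtrema.
Variable R : realType.

(** Each gap between consecutive nodes contains a sign change. As [D] does not vanish at the nodes,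
    the zeros lie strictly inside the gaps and are distinct. *)
Lemma alternation_zeros (D : R -> R) (x : nat -> R) m : continuous D ->
  (forall i, (i < m)%N -> x i < x i.+1) ->
  (forall i, (i <= m)%N -> (-1) ^+ i * D (x i) < 0) ->
  exists2 r, uniq r /\ size r = m & {in r, forall z, x 0 < z < x m /\ D z = 0}.
Proof.
move=> cD; elim: m => [|m IH] xS xD; first by exists [::].
have [i im|i im|r [ur rm] r0] := IH; first by apply: xS; apply: ltnW.
  by apply: xD; apply: leqW.
have xm := xS m (ltnSn m).
have [z] : exists2 z, z \in `[x m, x m.+1] & D z = 0.
  apply: IVT; [exact: ltW | exact: continuous_subspaceT |].
  have := xD m.+1 (leqnn _); have := xD m (leqnSn _).
  rewrite exprS mulN1r mulNr oppr_lt0 ge_min le_max -signr_odd.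
  by case: (odd m); rewrite ?expr0 ?expr1 ?mul1r ?mulN1r ?oppr_lt0 ?oppr_gt0 =>
    /ltW-> /ltW->; rewrite ?orbT.
rewrite in_itv /= => /andP[mz zm] Dz.
have nz i : (i <= m.+1)%N -> z != x i.
  move=> /xD; apply: contraTneq => <-; by rewrite Dz mulr0 ltxx.
have {}mz : x m < z by rewrite lt_neqAle eq_sym nz.
have {}zm : z < x m.+1 by rewrite lt_neqAle nz.
have x0m : x 0 <= x m.
  elim: (m) xS => [//|k IHk] xS; apply: le_trans (IHk _) (ltW (xS k _)) => // i ik.
  by apply: xS; apply: ltnW.
exists (z :: r) => [|y]; rewrite /= ?rm ?ur ?andbT; first split => //.
  by apply/negP => /r0[/andP[_ /lt_trans/(_ mz)]]; rewrite ltxx.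
rewrite inE => /predU1P[->|/r0[/andP[xy ym] ->]].
  by rewrite zm (le_lt_trans x0m mz).
by rewrite xy (lt_trans ym xm).
Qed.

(* Otherwise [(1 + eta) * M * cos (N * (t - tau))], with the maximum and minimum at
   [tau] and [tau + pi / N] placed symmetrically around [b] and [b + h], would meet
   the given polynomial too often in a half circle. *)
Lemma homtrig_extrema_gap N a (M b h : R) : (0 < N)%N -> 0 < M ->
  (forall t, `|homtrig N a t| <= M) -> homtrig N a b = M ->
  homtrig N a (b + h) = - M -> 0 <= h -> pi / N%:R <= h.
Proof.
move=> N0 M0 aM ab abh; rewrite le_eqVlt => /predU1P[h0|h0].
  by move: abh; rewrite -h0 addr0 ab => /eqP; rewrite -addr_eq0 gt_eqF // addr_gt0.
rewrite leNgt; apply/negP => hN.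
have N1 : 0 < N%:R :> R by rewrite ltr0n.
have pi0 : 0 < pi :> R := pi_gt0 R.
pose q : R := pi / N%:R; have qN : N%:R * q = pi by rewrite /q mulrC divfK ?gt_eqF.
have q0 : 0 < q by rewrite divr_gt0.
have hq : h < q := hN.
(* The points [tau] and [tau + q] have the same midpoint as 0 and [h]; the comparison cosine takes
   the values [s] at 0 and [- s] at [h]. *)
pose tau := h / 2 - q / 2; pose s := sin (N%:R * h / 2).
have Nh : 0 < N%:R * h / 2 < pi / 2.
  by rewrite !divr_gt0 ?mulr_gt0 //= -qN ltr_pM2r // ltr_pM2l.
have s0 : 0 < s by apply: sin_gt0_pihalf.
have s1 : s < 1.
  by rewrite -sin_pihalf ltr_sin ?in_itv /=; move: Nh; lra.
(* The amplitude [(1 + eta) * M] exceeds [M] at the extrema of the cosine, yet stays below [M] in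
   absolute value at 0 and [h]. *)
pose eta := (1 - s) / 2; have eta0 : 0 < eta by rewrite divr_gt0 // subr_gt0.
have etas : (1 + eta) * s < 1 by rewrite /eta; nra.
have [f [fE aff f0 fh]] : exists f,
    [/\ is_homtrig N f, forall t, `|f t| <= M, f 0 = M & f h = - M].
  exists (fun t => homtrig N a (t + b)); split; rewrite ?add0r 1?addrC //.
    by apply: is_homtrig_shift; exists a.
have [c cE] : is_homtrig N (fun t => (1 + eta) * M * cos (N%:R * (t - tau)) + -1 * f t).
  by apply: is_homtrigD; apply: is_homtrigZ => //; apply: is_homtrig_cos.
(* The first two extrema [tau] and [tau + q] are bracketed by different nodes: 0 and [h] come first,
   then the extrema from [tau + q] to [tau + N * q]. This gives [N.+1] gaps. *)
pose x (i : nat) : R := if i is i'.+1 then if i' is 0 then h else tau + i'%:R * q else 0.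
have cosj j : cos (N%:R * (tau + j%:R * q - tau)) = (-1) ^+ j :> R.
  rewrite addrC addKr mulrCA qN -[_ * pi]add0r mulr_natl.
  by rewrite (alternatingn (@cosDpi R)) cos0 mulr1.
have [i|i|r [ur rN] r0] := @alternation_zeros (homtrig N c) x N.+1 (@homtrig_continuous _ _ _).
- case: i => [|[|i]] iN; rewrite /x //.
    by rewrite /tau; lra.
  by rewrite ltrD2l ltr_pM2r // ltr_nat.
- rewrite -cE; case: i => [|[|i]] iN; rewrite /x.
  + rewrite f0 expr0 mul1r sub0r.
    have -> : N%:R * - tau = pi / 2 - N%:R * h / 2 by rewrite -qN /tau; lra.
    rewrite -cosN opprB cosBpihalf -/s; nra.
  + rewrite fh expr1 mulN1r.
    have -> : N%:R * (h - tau) = N%:R * h / 2 + pi / 2 by rewrite -qN /tau; lra.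
    rewrite cosDpihalf -/s; nra.
  + rewrite cosj; have := aff (tau + i.+1%:R * q); rewrite ler_norml => /andP[].
    rewrite [_ ^+ i.+2]exprS -[(-1) ^+ i.+1]signr_odd.
    by case: (odd _); rewrite ?expr0 ?expr1; nra.
(* The zeros lie in the interval from 0 to [pi]; the shift moves them to where [homtrig_roots]
   applies. *)
have [d dE] := is_homtrig_shift (pi / 2) (ex_intro _ c (fun t => erefl (homtrig N c t))).
have xN : x N.+1 < pi.
  by rewrite /x; case: (N) N0 qN => // N' _ qN; rewrite qN /tau; lra.
have d0 : forall j, (j <= N)%N -> d j = 0.
  apply: (@homtrig_roots _ N d [seq t - pi / 2 | t <- r]).
  - by rewrite map_inj_uniq // => y z /addIr.
  - by rewrite size_map rN.
  move=> y /mapP[t /r0[/andP[t0 tx] t00] ->]; rewrite -dE subrK; split=> //.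
  by move: t0; rewrite /= /x in tx *; move: (lt_trans tx xN); lra.
(* The difference would vanish identically, but at 0 it equals [(1 + eta) * M * s - M < 0]. *)
have := dE (- (pi / 2)); rewrite addNr -cE f0 /homtrig [RHS]big1 => [|j _]; last first.
  by rewrite d0 ?mul0r // -ltnS.
have -> : N%:R * (0 - tau) = pi / 2 - N%:R * h / 2 by rewrite -qN /tau; lra.
by rewrite -cosN opprB cosBpihalf -/s; nra.
Qed.

End RieszExtrema.

Section CircleMaxima.
Variable R : realType.
Implicit Types (a : nat -> R).

Lemma eq_homtrig N a (s t : R) : cos s = cos t -> sin s = sin t ->
  homtrig N a s = homtrig N a t.
Proof. by rewrite /homtrig => -> ->. Qed.

Lemma cos_acos_cos (t : R) : cos (acos (cos t)) = cos t.
Proof. by rewrite acosK // in_itv /= cos_geN1 cos_le1. Qed.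

Lemma sin_acos_cos (t : R) : sin (acos (cos t)) = `|sin t|.
Proof. by rewrite sin_acos ?cos_geN1 ?cos_le1 // -sin2cos2 sqrtr_sqr. Qed.

Lemma angle_reduction (t : R) :
  exists2 u, 0 <= u <= pi *+ 2 & cos u = cos t /\ sin u = sin t.
Proof.
have cB : -1 <= cos t <= 1 by rewrite cos_geN1 cos_le1.
have a0 := acos_ge0 cB; have api := acos_lepi cB; have pi0 := pi_ge0 R.
have [s0|s0] := leP 0 (sin t).
  exists (acos (cos t)); first by rewrite mulr2n; lra.
  by rewrite cos_acos_cos sin_acos_cos ger0_norm.
exists (- acos (cos t) + pi *+ 2); first by rewrite mulr2n; lra.
by rewrite cosD2pi sinD2pi cosN sinN cos_acos_cos sin_acos_cos ltr0_norm // opprK.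
Qed.

Lemma homtrig_argmax N a :
  exists2 u, 0 <= u <= pi *+ 2 & forall t, homtrig N a t <= homtrig N a u.
Proof.
have [//||u uI um] := @EVT_max R (homtrig N a) 0 (pi *+ 2).
- by rewrite mulrn_wge0 // pi_ge0.
- by apply: continuous_subspaceT; apply: homtrig_continuous.
exists u => [|t]; first by move: uI; rewrite in_itv.
have [t' t'I [ct st]] := angle_reduction t.
by rewrite -(eq_homtrig N a ct st) um // in_itv.
Qed.

Lemma homtrig_eq0 N a : (forall t, homtrig N a t = 0) -> forall j, (j <= N)%N -> a j = 0.
Proof.
(* The [N.+1] sample points lie between 0 and 1, and [pi / 2] is at least 1. *)
move=> a0; apply: (@homtrig_roots _ N a [seq i%:R / N.+1%:R | i <- iota 0 N.+1]).
- rewrite map_inj_uniq ?iota_uniq // => i j /(divIf _)/eqP; rewrite pnatr_eq0 eqr_nat.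
  by move=> /(_ isT)/eqP.
- by rewrite size_map size_iota.
move=> t /mapP[i]; rewrite mem_iota add0n => /andP[_ iN] ->; split=> //.
have pi1 := pihalf_ge1 R; have i0 : 0 <= i%:R / N.+1%:R :> R by rewrite divr_ge0.
have : i%:R / N.+1%:R < 1 :> R by rewrite ltr_pdivrMr ?ltr0n // mul1r ltr_nat.
by move: i0 pi1; set y := i%:R / _; set p := pi / 2; lra.
Qed.

(** For odd [N] the antipode of a maximum point is a minimum point with the opposite value. If the
    maxima are at angle [th], one of them is at angle [pi - th] from the antipode of the other, and
    [homtrig_extrema_gap] bounds this below. *)
Lemma homtrig_maxima_close N a (s t : R) : odd N ->
  (forall u, homtrig N a u <= homtrig N a s) ->
  (forall u, homtrig N a u <= homtrig N a t) ->
  (exists2 j, (j <= N)%N & a j != 0) ->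
  acos (cos (s - t)) <= pi - pi / N%:R.
Proof.
move=> oN smax tmax [j jN aj].
have aDpi u : homtrig N a (u + pi) = - homtrig N a u.
  by rewrite homtrigDpi -signr_odd oN mulN1r.
have st : homtrig N a s = homtrig N a t by apply/le_anti; rewrite smax tmax.
pose M := homtrig N a s.
have aM u : `|homtrig N a u| <= M by rewrite ler_norml lerNl -aDpi !smax.
have M0 : 0 < M.
  have M0 : 0 <= M by apply: le_trans (aM 0).
  rewrite lt_neqAle eq_sym M0 andbT; apply: contra aj => /eqP Mz; apply/eqP.
  apply: homtrig_eq0 jN => u; apply/eqP; rewrite -normr_le0; apply: le_trans (aM u) _.
  by rewrite Mz.
have sub s' t' : homtrig N a s' = M -> homtrig N a t' = M -> 0 <= sin (s' - t') ->
    acos (cos (s' - t')) <= pi - pi / N%:R.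
  move=> s'M t'M sin0; pose th := acos (cos (s' - t')).
  have cB : -1 <= cos (s' - t') <= 1 by rewrite cos_geN1 cos_le1.
  have cth : cos (s' - t') = cos th by rewrite cos_acos_cos.
  have sth : sin (s' - t') = sin th by rewrite sin_acos_cos ger0_norm.
  rewrite lerBrDr addrC -lerBrDr.
  apply: (homtrig_extrema_gap (a := a) (M := M) (b := s')) => //.
  - by case: (N) oN.
  (* The angles [s' - t'] and [th] agree only modulo full turns; adding the same [e] to both lets
     the addition formulas replace a congruence. *)
  - have [e [se te]] : exists e, s' + (pi - th) = (s' - t') + e /\ t' + pi = th + e.
      by exists (t' + pi - th); split; lra.
    rewrite -t'M -aDpi se te; apply: eq_homtrig.
      by rewrite [LHS]cosD [RHS]cosD cth sth.
    by rewrite [LHS]sinD [RHS]sinD cth sth.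
  - by rewrite subr_ge0 acos_lepi.
have [sin0|sin0] := leP 0 (sin (s - t)); first by apply: sub; rewrite -?st.
rewrite -cosN opprB; apply: sub; rewrite -?st //.
by rewrite -opprB sinN oppr_ge0 ltW.
Qed.

End CircleMaxima.

(** * Passage to the limit *)

Section ClusterLimit.
Variables (R : realType) (X : topologicalType) (u : nat -> X) (x : X).
Hypothesis ux : cluster (u @ \oo) x.

Lemma cluster_le0 (G : X -> R) (C : R) : {for x, continuous G} ->
  (forall l, G (u l) <= C / l.+1%:R) -> G x <= 0.
Proof.
move=> cG Gu; rewrite leNgt; apply/negP => Gx.
have G2 : G x / 2 < G x by lra.
have [y []] : [set y | G y <= G x / 2] `&` [set y | G x / 2 < G y] !=set0.
  apply: ux; last exact: (cvgr_gt (G x) cG).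
  (* Adding 1 keeps the divisor positive when [C] is 0. *)
  have /cvgrPdist_le/(_ (G x / 2 / (`|C| + 1))) := @cvg_harmonic R.
  have C1 : 0 < `|C| + 1 by rewrite ltr_wpDl.
  rewrite !divr_gt0 // => /(_ isT) [l _ lP]; exists l => // m /lP /=.
  rewrite sub0r normrN ger0_norm ?invr_ge0 // ler_pdivlMr // => h.
  apply: le_trans (Gu m) (le_trans _ h); rewrite mulrC ler_wpM2l ?invr_ge0 //.
  by have := ler_norm C; lra.
by move=> /= h1 h2; move: (lt_le_trans h2 h1); rewrite ltxx.
Qed.

End ClusterLimit.

Section CirclePoints.
Variable R : realType.

Lemma sphere_circle_point (t : R) : @sphere R 1 (circle_point t).
Proof.
by rewrite /sphere /= /dotv !big_ord_recl big_ord0 addr0 !mxE /= -!expr2 cos2Dsin2.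
Qed.

Lemma geodist_circle_point (s t : R) :
  geodist (circle_point s) (circle_point t) = acos (cos (s - t)).
Proof. by rewrite /geodist /dotv !big_ord_recl big_ord0 addr0 !mxE /= -cosB. Qed.

Lemma circle_pointDpi (t : R) : circle_point (t + pi) = - circle_point t.
Proof. by apply/rowP => i; rewrite !mxE; case: ifP; rewrite ?cosDpi ?sinDpi. Qed.

Lemma circle_point_continuous : continuous (@circle_point R).
Proof.
move=> t; apply/cvg_ballP => e e0.
have /cvgrPdist_lt/(_ e e0) nc := @continuous_cos R t.
have /cvgrPdist_lt/(_ e e0) ns := @continuous_sin R t.
near=> s; split=> // i j; rewrite !mxE -ball_normE /=.
by case: ifP => _; near: s.
Unshelve. all: by end_near. Qed.

Lemma within_sphere_continuous (U : topologicalType) (f : 'rV[R]_2 -> U) :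
  {within @sphere R 1, continuous f} -> continuous (f \o @circle_point R).
Proof.
move=> /subspace_continuousP fc t; apply: cvg_trans (fc _ (sphere_circle_point t)).
move=> A fA; have ct : nbhs t [set s | sphere (circle_point s) -> A (f (circle_point s))].
  exact: (circle_point_continuous fA).
suff : nbhs t [set s | A (f (circle_point s))] by [].
by apply: filterS ct => s /=; apply; apply: sphere_circle_point.
Qed.

End CirclePoints.

(** * An odd choice of maximum points *)

Section FirstMaximum.
Variables (R : realType) (n : nat).
Implicit Types v w : 'rV[R]_n.+1.

Definition htrig v := homtrig n (fun j => v 0 (inord j)).

Lemma htrigN v t : htrig (- v) t = - htrig v t.
Proof. by rewrite /htrig /homtrig -sumrN; apply: eq_bigr => j _; rewrite mxE mulNr. Qed.

Lemma htrig_lipschitz v w (d t : R) : (forall i, `|v 0 i - w 0 i| <= d) ->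
  `|htrig v t - htrig w t| <= n.+1%:R * d.
Proof.
move=> vw; rewrite /htrig /homtrig -sumrB; apply: le_trans (ler_norm_sum _ _ _) _.
rewrite mulr_natl -[in leRHS](card_ord n.+1) -sumr_const; apply: ler_sum => j _.
rewrite -mulrBl normrM -[leRHS]mulr1 ler_pM // normrM !normrX.
by rewrite mulr_ile1 ?exprn_ge0 // exprn_ile1 // ?cos_max ?sin_max.
Qed.

(** A maximum point is chosen in one turn for each representative; for the opposite form it is
    shifted by [pi], which exchanges the maxima of [v] and [- v]. Hence the range up to [3 * pi]. *)
Lemma exists_odd_argmax : odd n -> exists T : 'rV[R]_n.+1 -> R,
  [/\ forall v, 0 <= T v <= 3 * pi, forall v t, htrig v t <= htrig v (T v)
    & forall v, v != 0 -> T (- v) = T v + pi \/ T v = T (- v) + pi].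
Proof.
move=> on; have hDpi v t : htrig v (t + pi) = - htrig v t.
  by rewrite /htrig homtrigDpi -signr_odd on mulN1r.
have [T0 T0P] : {T0 : 'rV[R]_n.+1 -> R & forall v,
    (0 <= T0 v <= pi *+ 2) /\ forall t, htrig v t <= htrig v (T0 v)}.
  apply: (@boolp.choice _ _ (fun v u =>
    (0 <= u <= pi *+ 2) /\ forall t, htrig v t <= htrig v u)) => v.
  have [u uI uM] := homtrig_argmax n (fun j => v 0 (inord j)).
  by exists u.
have pi0 := pi_ge0 R.
exists (fun v => if rep v == v then T0 v else T0 (- v) + pi); split=> [v|v t|v v0].
- have [a1 _] := T0P v; have [a2 _] := T0P (- v); move: a1 a2; rewrite !mulr2n.
  by case: ifP => _; lra.
- case: ifP => _; first exact: (T0P v).2.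
  by rewrite hDpi -htrigN -[t](subrK pi) hDpi -htrigN (T0P (- v)).2.
have vN : v != - v.
  by rewrite -addr_eq0 -mulr2n -scaler_nat scaler_eq0 pnatr_eq0.
rewrite repN opprK; case: (repP v) => ->; rewrite eqxx.
  by rewrite (negPf vN); left.
by rewrite eq_sym (negPf vN); right.
Qed.

End FirstMaximum.

(** * Balanced maximum points by compactness *)

Section BalancedMaxima.
Variables (R : realType) (n : nat) (F : R -> 'rV[R]_n.+1).
Hypotheses (n_odd : odd n.+1) (F_cont : continuous F).
Hypothesis FDpi : forall t, F (t + pi) = - F t.

(** A point records the coefficients of a form, a tuple of candidate maximum points and a tuple of
    weights. *)
Let X := ('rV[R]_n.+2 * 'rV[R]_n.+2 * 'rV[R]_n.+2)%type.

Let box (a b : R) : set 'rV[R]_n.+2 := [set v | forall i, `[a, b]%classic (v 0 i)].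

Let K : set X :=
  (box (-1) 1 `*` box 0 (3 * pi)) `*` box 0 1.

(** One vertex of a small simplex stands for all of them: maximum points of the other vertices
    nearly maximise it, with two Lipschitz errors. Errors are written as [C / l.+1%:R] to suit
    [cluster_le0]. *)
Lemma approximate_balanced_maxima (l : nat) :
  exists y : X,
    [/\ K y, forall u i, htrig y.1.1 u - htrig y.1.1 (y.1.2 0 i) <= 2 * n.+2%:R / l.+1%:R,
        forall j, `|\sum_i y.2 0 i * F (y.1.2 0 i) 0 j| <= 1 / l.+1%:R,
        1 - \sum_i `|y.1.1 0 i| <= 0 / l.+1%:R
      & `|1 - \sum_i y.2 0 i| <= 0 / l.+1%:R].
Proof.
have [T [TI Tmax Todd]] := exists_odd_argmax R n_odd.
have g_odd v j : v != 0 -> F (T (- v)) 0 (inord j) = - F (T v) 0 (inord j).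
  by case/Todd => ->; rewrite FDpi mxE ?opprK.
have l0 : 0 < l.+1%:R^-1 :> R by rewrite invr_gt0 ltr0n.
have [s [w [[sn [a [a1 a2]]] [s1 sd] w0 w1 wF]]] := discrete_borsuk_ulam g_odd l0.
pose p (i : 'I_n.+2) := s`_i.
have ps i : p i \in s by rewrite mem_nth // sn.
have sum_s (G : 'rV[R]_n.+2 -> R) : \sum_(x <- s) G x = \sum_i G (p i).
  by rewrite (big_nth 0) big_mkord sn.
exists (p ord0, \row_i T (p i), \row_i w (p i)); split=> /=.
+ split; first split; move=> i; rewrite /= ?mxE in_itv /=.
  * by rewrite -ler_norml s1.
  * exact: TI.
  * rewrite w0 //= -w1 (big_rem _ (ps i)) /= lerDl big_seq sumr_ge0 // => x xr.
    by rewrite w0 // (mem_rem xr).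
+ move=> u i; rewrite mxE.
  have lip t x y : x \in s -> y \in s -> htrig x t - htrig y t <= n.+2%:R * l.+1%:R^-1.
    move=> xs ys; apply: le_trans (ler_norm _) _.
    by apply: htrig_lipschitz => j; apply: sd.
  have h1 := lip u _ _ (ps ord0) (ps i); have h2 := lip (T (p i)) _ _ (ps i) (ps ord0).
  by have := Tmax (p i) u; move: h1 h2; rewrite -mulrA; set c := n.+2%:R / _; lra.
+ move=> j; rewrite mul1r; have := wF j (ltn_ord j); rewrite sum_s inord_val.
  by congr (`|_| <= _); apply: eq_bigr => i _; rewrite !mxE.
(* The face form has coefficients in [-1, 1] and value 1, so the l1 norm is at least 1; this keeps
   the limit form away from 0. *)
+ rewrite mul0r subr_le0 -(a2 _ (ps ord0)); apply: ler_sum => i _.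
  by apply: le_trans (ler_norm _) _; rewrite normrM ler_piMl.
+ by rewrite mul0r -w1 sum_s -sumrB big1 ?normr0 // => i _; rewrite mxE subrr.
Qed.

(** The approximate solutions stay in a compact product of boxes, and a cluster point inherits every
    inequality with error 0. *)
Lemma exists_balanced_maxima : exists (v : 'rV[R]_n.+2) (t w : 'I_n.+2 -> R),
  [/\ v != 0, forall u i, htrig v u <= htrig v (t i), forall i, 0 <= w i,
      \sum_i w i = 1 & \sum_i w i *: F (t i) = 0].
Proof.
have [y yP] := @boolp.choice _ _ _ approximate_balanced_maxima.
have cK : compact K.
  have cbox a b : compact (box a b).
    by apply: (@rV_compact R n.+2 (fun=> `[a, b]%classic)) => i; apply: segment_compact.
  by apply: compact_setX => //; apply: compact_setX.
have [x [Kx yx]] : K `&` cluster (y @ \oo) !=set0.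
  by apply: cK; exists 0%N => // l _; case: (yP l).
have c11 i : {for x, continuous (fun z : X => z.1.1 0 i)}.
  apply: (@continuous_comp _ _ _ (fun z => z.1.1) (fun v : 'rV[R]_n.+2 => v 0 i)).
    by apply: continuous_comp; apply: cvg_fst.
  exact: coord_continuous.
have c12 i : {for x, continuous (fun z : X => z.1.2 0 i)}.
  apply: (@continuous_comp _ _ _ (fun z => z.1.2) (fun v : 'rV[R]_n.+2 => v 0 i)).
    by apply: continuous_comp; [apply: cvg_fst | apply: cvg_snd].
  exact: coord_continuous.
have c2 i : {for x, continuous (fun z : X => z.2 0 i)}.
  apply: (@continuous_comp _ _ _ snd (fun v : 'rV[R]_n.+2 => v 0 i)).
    exact: cvg_snd.
  exact: coord_continuous.
exists x.1.1, (x.1.2 0), (x.2 0).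
have xmax u i : htrig x.1.1 u <= htrig x.1.1 (x.1.2 0 i).
  rewrite -subr_le0.
  pose G (z : X) :=
    htrig z.1.1 u - htrig z.1.1 (z.1.2 0 i).
  apply: (cluster_le0 yx (G := G) (C := 2 * n.+2%:R)) => [|l]; last by have [_ ->] := yP l.
  apply: continuousB; apply: continuous_at_sum => j; (apply: continuousM; first exact: c11).
    exact: cst_continuous.
  by apply: continuousM; apply: continuous_at_expr; apply: continuous_comp;
    [exact: c12 | exact: continuous_cos | exact: c12 | exact: continuous_sin].
have x0 : 1 - \sum_i `|x.1.1 0 i| <= 0.
  pose G (z : X) := 1 - \sum_i `|z.1.1 0 i|.
  apply: (cluster_le0 yx (G := G) (C := 0)) => [|l]; last by have [_ _ _ ->] := yP l.
  apply: continuousB; first exact: cst_continuous.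
  apply: continuous_at_sum => j; apply: continuous_comp; first exact: c11.
  exact: norm_continuous.
have w1 : `|1 - \sum_i x.2 0 i| <= 0.
  pose G (z : X) := `|1 - \sum_i z.2 0 i|.
  apply: (cluster_le0 yx (G := G) (C := 0)) => [|l]; last by have [_ _ _ _ ->] := yP l.
  apply: continuous_comp; last exact: norm_continuous.
  apply: continuousB; first exact: cst_continuous.
  exact: continuous_at_sum.
have wF j : `|\sum_i x.2 0 i * F (x.1.2 0 i) 0 j| <= 0.
  pose G (z : X) :=
    `|\sum_i z.2 0 i * F (z.1.2 0 i) 0 j|.
  apply: (cluster_le0 yx (G := G) (C := 1)) => [|l]; last by have [_ _ ->] := yP l.
  apply: continuous_comp; last exact: norm_continuous.
  apply: continuous_at_sum => i; apply: continuousM; first exact: c2.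
  apply: (@continuous_comp _ _ _ (fun z : X => F (z.1.2 0 i))
    (fun v : 'rV[R]_n.+1 => v 0 j)).
    by apply: continuous_comp; [exact: c12 | exact: F_cont].
  exact: coord_continuous.
split=> //.
- apply: contraTneq x0 => ->; rewrite big1 ?subr0 -?ltNge ?ltr01 // => i _.
  by rewrite mxE normr0.
- by move=> i; case: Kx => _ /(_ i); rewrite /= in_itv /= => /andP[].
- by apply/esym/eqP; rewrite -subr_eq0 -normr_le0.
apply/rowP => j; rewrite summxE mxE; apply/eqP; rewrite -normr_le0.
by rewrite (eq_bigr (fun i => x.2 0 i * F (x.1.2 0 i) 0 j)) // => i _; rewrite mxE.
Qed.

End BalancedMaxima.

Theorem theorem1 (R : realType) (k : nat)
    (f : 'rV[R]_2 -> 'rV[R]_(2 * k).+1)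
    (f_odd : @odd_map R 1 (2 * k).+1 f)
    (f_cont : {within @sphere R 1, continuous f}) :
  exists X : set 'rV[R]_2,
    [/\ X `<=` @sphere R 1,
        (diam (@geodist R 2) X <= (2 * pi * k%:R / (2 * k + 1)%:R)%:E)%E
      & conv (f @` X) 0].
Proof.
have n_odd : odd (2 * k).+1 by rewrite /= oddM.
have FDpi t : f (circle_point (t + pi)) = - f (circle_point t).
  by rewrite circle_pointDpi f_odd //; apply: sphere_circle_point.
have [v [t [w [v0 vmax w0 w1 wF]]]] :=
  exists_balanced_maxima n_odd (within_sphere_continuous f_cont) FDpi.
exists [set circle_point (t i) | i in setT]; split.
- by move=> _ [i _ <-]; apply: sphere_circle_point.
- apply: ub_ereal_sup => _ [_ [_ [[i _ <-] [j _ <-] ->]]].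
  rewrite lee_fin geodist_circle_point.
  (* The diameter bound is the Riesz bound for degree [(2 * k).+1]. *)
  have -> : 2 * pi * k%:R / (2 * k + 1)%:R = pi - pi / (2 * k).+1%:R :> R.
    have N1 : (2 * k).+1%:R = 2 * k%:R + 1 :> R by rewrite -natr1 natrM.
    by rewrite addn1 N1; field; rewrite -N1 pnatr_eq0.
  apply: (homtrig_maxima_close n_odd (vmax^~ i) (vmax^~ j)).
  have /rV0Pn[l vl] := v0.
  by exists l; rewrite ?inord_val // -ltnS.
exists (2 * k).+2, (f \o @circle_point R \o t), w; split=> // i.
by exists (circle_point (t i)) => //; exists i.
Qed.
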